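(* Let $k$ be an algebraically closed field (of arbitrary characteristic). There exists a local Artinian Gorenstein $k$-algebra $A$ of length $31$ and embedding dimension $14$ such that $A$ is not smoothable, while $Q_A(0)$ is smoothable.
   Context: All local Artinian $k$-algebras are finite-dimensional over $k$ (so the residue field is $k$, and length equals $\dim_k$). For a local Artinian algebra $A$ with maximal ideal $\mathfrak m_A$, the embedding dimension is $\dim_k \mathfrak m_A/\mathfrak m_A^2$. Symmetric decomposition (Iarrobino): let $A$ be a local Artinian Gorenstein $k$-algebra of socle degree $j$ (the largest $j$ with $\mathfrak m_A^j\neq 0$), and let $\operatorname{Gr}_{\mathfrak m_A}(A)=\bigoplus_i \mathfrak m_A^i/\mathfrak m_A^{i+1}$ be its associated graded algebra. For $a\ge 0$ let $C_A(a)\subset \operatorname{Gr}_{\mathfrak m_A}(A)$ be the homogeneous ideal whose degree-$i$ component is $$C_A(a)_i=\frac{\mathfrak m_A^i\cap(0:\mathfrak m_A^{\,j+1-a-i})}{\mathfrak m_A^{i+1}\cap(0:\mathfrak m_A^{\,j+1-a-i})},$$ where $\mathfrak m_A^{s}=A$ for $s\le 0$. Put $Q_A(a)=C_A(a)/C_A(a+1)$. Since $C_A(0)=\operatorname{Gr}_{\mathfrak m_A}(A)$, the first symmetric quotient $Q_A(0)=\operatorname{Gr}_{\mathfrak m_A}(A)/C_A(1)$ is a graded $k$-algebra. Smoothability: a finite $k$-algebra $B$ of length $n$ is smoothable if, for a closed embedding $\operatorname{Spec} B\subset\mathbb A^N_k$ (the condition does not depend on the choice of $N$ or of the embedding), the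 corresponding point of the Hilbert scheme $\operatorname{Hilb}^n(\mathbb A^N)$ of length-$n$ subschemes lies in the Zariski closure of the open locus parametrizing reduced subschemes, i.e. configurations of $n$ distinct points. *)

(* Defs.v *)
From HB Require Import structures.
From mathcomp Require Import all_boot all_order all_algebra falgebra.
From mathcomp Require Import generic_quotient ring_quotient.
From mathcomp.multinomials Require Import mpoly.

Set Implicit Arguments.
Unset Strict Implicit.
Unset Printing Implicit Defensive.

Import GRing.Theory.
Local Open Scope ring_scope.
Local Open Scope quotient_scope.

(* Commutative finite-dimensional algebras over a field; falgType alone does
   not require commutativity. *)
#[short(type="comFalgType")]
HB.structure Definition ComFalgebra (K : nzRingType) :=
  {A of GRing.ComUnitAlgebra K A & Vector K A}.

(* The quotient ring {ideal_quot I} of a commutative K-algebra is again a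
   K-algebra. *)
Section QuotientAlgebra.
Variables (K : fieldType) (R : comAlgType K) (I : idealr R).
Local Notation Q := (@Quotient.quot R I).

Definition quot_scale (c : K) (x : Q) : Q := \pi_Q (c *: repr x).

Lemma quot_scale_pi c (x : R) : quot_scale c (\pi_Q x) = \pi_Q (c *: x).
Proof.
rewrite /quot_scale; apply/eqP; rewrite -Quotient.idealrBE -scalerBr.
by rewrite -mulr_algl; apply: idealMr; rewrite Quotient.idealrBE reprK.
Qed.

Lemma quot_scaleA c d x : quot_scale c (quot_scale d x) = quot_scale (c * d) x.
Proof. by rewrite -[x]reprK (quot_scale_pi d) !quot_scale_pi scalerA. Qed.

Lemma quot_scale1 : left_id 1 quot_scale.
Proof. by move=> x; rewrite -[x]reprK !quot_scale_pi scale1r. Qed.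

Lemma quot_scaleDr : right_distributive quot_scale +%R.
Proof.
move=> c x y; rewrite -[x]reprK -[y]reprK -[_ + _]rmorphD.
by rewrite !quot_scale_pi scalerDr rmorphD.
Qed.

Lemma quot_scaleDl x : {morph quot_scale^~ x : c d / c + d}.
Proof.
by move=> c d; rewrite -[x]reprK !quot_scale_pi scalerDl rmorphD.
Qed.

HB.instance Definition _ := GRing.Zmodule_isLmodule.Build K (Quotient.quot I)
  quot_scaleA quot_scale1 quot_scaleDr quot_scaleDl.

Lemma quot_scaleAl (c : K) (x y : Q) : c *: (x * y) = (c *: x) * y.
Proof.
rewrite -[LHS]/(quot_scale c (x * y)) -[c *: x]/(quot_scale c x).
rewrite -[x]reprK -[y]reprK -rmorphM.
by rewrite (quot_scale_pi c (_ * _)) (quot_scale_pi c (repr x)) scalerAl rmorphM.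
Qed.

HB.instance Definition _ :=
  GRing.Lmodule_isLalgebra.Build K (Quotient.quot I) quot_scaleAl.
HB.instance Definition _ :=
  GRing.Lalgebra_isComAlgebra.Build K (Quotient.quot I).

End QuotientAlgebra.

Section Ideals.
Variables (K : fieldType) (A : comFalgType K).
Implicit Types I J : {vspace A}.

Definition is_ideal I : bool := (fullv * I <= I)%VS.

Definition maximal_ideal I : Prop :=
  [/\ is_ideal I, I != fullv &
      forall J, is_ideal J -> (I <= J)%VS -> J != fullv -> J = I].

(* MathComp's I ^+ 0 is the line K.1, whereas the zeroth power of an ideal is
   the whole algebra. *)
Definition ideal_exp I (n : nat) : {vspace A} :=
  if n is 0 then fullv else (I ^+ n)%VS.

Definition annihilator I : {vspace A} :=
  (\bigcap_(u <- vbasis I) lker (amulr u))%VS.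

Lemma annihilatorP I x :
  reflect (forall u, u \in I -> x * u = 0) (x \in annihilator I).
Proof.
have E (s : seq A) : (x \in (\bigcap_(u <- s) lker (amulr u))%VS)
    = all (fun u => x * u == 0) s.
  elim: s => [|u s IH]; first by rewrite big_nil memvf.
  by rewrite big_cons memv_cap IH memv_ker lfunE.
rewrite /annihilator E; apply: (iffP allP) => [H u uI|H u uI].
  rewrite (coord_vbasis uI) mulr_sumr big1 // => i _.
  rewrite -scalerAr (eqP (H _ _)) ?scaler0 //.
  by rewrite mem_nth // size_tuple.
by apply/eqP/H/vbasis_mem.
Qed.

Lemma ideal_memM I a x : is_ideal I -> x \in I -> a * x \in I.
Proof. by move=> /subvP H xI; apply/H/memv_mul; rewrite ?memvf. Qed.

Lemma is_idealP I : (forall a x, x \in I -> a * x \in I) -> is_ideal I.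
Proof. by move=> H; apply/prodvP => a x _; apply: H. Qed.

Lemma annihilator_ideal I : is_ideal (annihilator I).
Proof.
apply: is_idealP => a x /annihilatorP H; apply/annihilatorP => u uI.
by rewrite -mulrA H ?mulr0.
Qed.

Lemma ideal_exp_ideal I n : is_ideal I -> is_ideal (ideal_exp I n).
Proof.
move=> HI; case: n => [|n]; first exact: subvf.
by rewrite /is_ideal /ideal_exp expvSl prodvA prodvSl.
Qed.

Lemma ideal_expS I n : is_ideal I -> (ideal_exp I n.+1 <= ideal_exp I n)%VS.
Proof.
move=> HI; case: n => [|n]; first exact: subvf.
rewrite [ideal_exp I n.+2]expvSl; apply: subv_trans (ideal_exp_ideal n.+1 HI).
by rewrite prodvSl ?subvf.
Qed.

Lemma ideal_exp_le I m n : is_ideal I -> (m <= n)%N ->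
  (ideal_exp I n <= ideal_exp I m)%VS.
Proof.
move=> HI /subnK <-; elim: (n - m)%N => [|d IH]; first exact: subvv.
exact: subv_trans (ideal_expS _ HI) IH.
Qed.

Lemma ideal_expM I m n x y : is_ideal I ->
  x \in ideal_exp I m -> y \in ideal_exp I n -> x * y \in ideal_exp I (m + n).
Proof.
move=> HI; case: m => [|m] xI; first by apply/ideal_memM/ideal_exp_ideal.
case: n => [|n] yI.
  by rewrite addn0 mulrC; apply: ideal_memM => //; apply: ideal_exp_ideal.
by rewrite /ideal_exp addSn -addSn expvD memv_mul.
Qed.

End Ideals.

HB.mixin Record isLocal (K : fieldType) A of ComFalgebra K A := {
  maxideal : {vspace A};
  maxideal_maximal : maximal_ideal maxideal;
  maxideal_unique : forall I : {vspace A}, maximal_ideal I -> I = maxideal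
}.

#[short(type="localAlgType")]
HB.structure Definition LocalAlgebra (K : fieldType) :=
  {A of isLocal K A & ComFalgebra K A}.

Notation "'\m_' A" := (@maxideal _ A)
  (at level 8, A at level 2, format "'\m_' A").

Section LocalAlgebras.
Variables (K : fieldType) (A : localAlgType K).
Local Notation m := (\m_A).

(* The largest j with m^j != 0, see socle_degree_max; the bound on i is harmless
   since the m^i strictly decrease to 0. *)
Definition socle_degree : nat :=
  \max_(i < (\dim (fullv : {vspace A})).+1 | ideal_exp m i != 0%VS) i.

(* One-dimensional socle; the residue field is K when K is algebraically
   closed. *)
Definition gorenstein : Prop := \dim (annihilator m) = 1.

Definition embdim : nat := \dim m - \dim (ideal_exp m 2).

Lemma maxideal_ideal : is_ideal m.
Proof. by case: (@maxideal_maximal _ A). Qed.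
Hint Resolve maxideal_ideal : core.

Lemma maxideal_neq : m != fullv.
Proof. by case: (@maxideal_maximal _ A). Qed.

Lemma is_ideal_full (I : {vspace A}) : is_ideal I -> 1 \in I -> I = fullv.
Proof.
move=> HI I1; apply/eqP; rewrite eqEsubv subvf /=; apply/subvP => x _.
by rewrite -[x]mulr1 ideal_memM.
Qed.

Lemma ideal_sub_maxideal (I : {vspace A}) :
  is_ideal I -> I != fullv -> (I <= m)%VS.
Proof.
have [n] := ubnP (\dim (fullv : {vspace A}) - \dim I)%N.
elim: n I => // n IH I ltn HI nI.
apply/negPn/negP => nIm; case/negP: (nIm).
suff HM : maximal_ideal I by rewrite (maxideal_unique I HM).
split=> // J HJ sIJ nJ; apply/eqP/negPn/negP => JI; case/negP: nIm.
apply: (subv_trans sIJ); apply: IH => //.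
have dlt : (\dim I < \dim J)%N.
  rewrite ltn_neqAle dimvS // andbT; apply/negP => E.
  by move: JI; rewrite eq_sym eqEdim sIJ (eqP E) leqnn.
rewrite -ltnS; apply: leq_trans ltn; rewrite ltnS.
by apply: ltn_sub2l => //; apply: leq_trans dlt (dimvS (subvf J)).
Qed.

Lemma one_notin_maxideal : 1 \notin m.
Proof.
by apply: contra maxideal_neq => m1; apply/eqP/is_ideal_full.
Qed.

Lemma amulr_full_ideal (v : A) : is_ideal (amulr v @: fullv)%VS.
Proof.
apply: is_idealP => a _ /memv_imgP[b _ ->].
by apply/memv_imgP; exists (a * b); rewrite ?memvf // !lfunE /= mulrA.
Qed.

Lemma maxideal_unit (x : A) : x \in m -> exists a, a * (1 - x) = 1.
Proof.
move=> xm; pose I := (amulr (1 - x) @: fullv)%VS.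
have [E|nE] := eqVneq I fullv.
  have := memvf (1 : A); rewrite -E => /memv_imgP[a _ E1].
  by exists a; rewrite [RHS]E1 lfunE.
have /subvP/(_ (1 - x)) := ideal_sub_maxideal (amulr_full_ideal (1 - x)) nE.
have h : 1 - x \in I.
  by apply/memv_imgP; exists 1; rewrite ?memvf // lfunE /= mul1r.
move=> /(_ h) h1; case/negP: one_notin_maxideal.
by rewrite -(subrK x 1) rpredD.
Qed.

Lemma ideal_nakayama (V : {vspace A}) :
  is_ideal V -> (V <= m * V)%VS -> V = 0%VS.
Proof.
move=> HV sV; apply/eqP/negPn/negP => V0.
have H0 : is_ideal (0 : {vspace A})%VS by rewrite /is_ideal prodv0 subvv.
suff H n (W : {vspace A}) : (\dim V - \dim W < n)%N ->
    is_ideal W -> (W <= V)%VS -> W != V -> False.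
  by apply: (H _ 0%VS (ltnSn _)); rewrite ?sub0v // eq_sym.
elim: n W => // n IH W ltn HW sWV nWV.
have: ~~ (V <= W)%VS by move: nWV; rewrite eqEsubv sWV.
case/subvPn => v vV vW.
pose W' := (W + amulr v @: fullv)%VS : {vspace A}.
have HW' : is_ideal W'.
  by rewrite /is_ideal prodvDr addvS //; apply: amulr_full_ideal.
have vW' : v \in W'.
  apply: subvP (addvSr _ _) _ _; apply/memv_imgP; exists 1.
    exact: memvf.
  by rewrite lfunE /= mul1r.
have sWW' : (W <= W')%VS by apply: addvSl.
have sW'V : (W' <= V)%VS.
  rewrite subv_add sWV; apply/subvP => _ /memv_imgP[a _ ->].
  by rewrite lfunE /= ideal_memM.
have dlt : (\dim W < \dim W')%N.
  rewrite ltn_neqAle dimvS // andbT; apply/negP => E.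
  have /eqP EW : W == W' by rewrite eqEdim sWW' (eqP E) leqnn.
  by rewrite EW vW' in vW.
have [E|nE] := eqVneq W' V; last first.
  apply: (IH W') => //; rewrite -ltnS; apply: leq_trans ltn; rewrite ltnS.
  by apply: ltn_sub2l => //; apply: leq_trans dlt (dimvS sW'V).
have: v \in (W + amulr v @: m)%VS.
  have: (m * W' <= W + amulr v @: m)%VS.
    rewrite prodvDr addvS //.
      by apply: subv_trans HW; rewrite prodvSl ?subvf.
    apply/prodvP => x _ xm /memv_imgP[a _ ->]; apply/memv_imgP.
    exists (a * x); first by rewrite ideal_memM.
    by rewrite !lfunE /= mulrA (mulrC x).
  by move/subvP; apply; rewrite E; apply: (subvP sV).
case/memv_addP => w wW [_ /memv_imgP[x xm ->] Ev].
have [a Ea] := maxideal_unit xm.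
case/negP: vW; rewrite -[v]mul1r -Ea -mulrA ideal_memM // mulrBl mul1r.
by rewrite {1}Ev lfunE /= addrK.
Qed.

Lemma ideal_exp_dim n :
  ideal_exp m n != 0%VS -> (n <= \dim (fullv : {vspace A}))%N.
Proof.
move=> nz; suff: (\dim (ideal_exp m n) + n <= \dim (fullv : {vspace A}))%N.
  by apply: leq_trans; apply: leq_addl.
elim: n nz => [_|n IH nz]; first by rewrite addn0.
have nz' : ideal_exp m n != 0%VS.
  apply: contra nz => /eqP z.
  by rewrite eqEsubv sub0v andbT -[X in (_ <= X)%VS]z ideal_expS.
apply: leq_trans (IH nz'); rewrite addnS -addSn leq_add2r ltn_neqAle.
rewrite dimvS ?ideal_expS // andbT; apply: contra nz' => E.
apply/eqP/ideal_nakayama; first exact: ideal_exp_ideal.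
have {1}<- : ideal_exp m n.+1 = ideal_exp m n.
  by apply/eqP; rewrite eqEdim ideal_expS // (eqP E) leqnn.
case: (n) => [|n']; last by rewrite {1}/ideal_exp expvSl.
by rewrite /ideal_exp expv1; apply/subvP => x xm; rewrite -[x]mulr1 memv_mul ?memvf.
Qed.

Lemma socle_degree_max :
  ideal_exp m socle_degree != 0%VS /\
  (forall n, ideal_exp m n != 0%VS -> (n <= socle_degree)%N).
Proof.
have nz0 : ideal_exp m 0 != 0%VS.
  apply: contra maxideal_neq => /eqP /= E.
  by rewrite eqEsubv subvf E sub0v.
split; last first.
  move=> n nz; have lt := ideal_exp_dim nz; rewrite -ltnS in lt.
  exact: (leq_bigmax_cond (Ordinal lt)).
pose P := [pred i : 'I_(\dim (fullv : {vspace A})).+1 | ideal_exp m i != 0%VS].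
have: (0 < #|P|)%N by apply/card_gt0P; exists ord0.
by case/(eq_bigmax_cond (@nat_of_ord _)) => i Pi E; rewrite /socle_degree E.
Qed.

End LocalAlgebras.

(* The Rees algebra of A, as the polynomials over A whose coefficient in degree
   i lies in m^i. *)
Section ReesAlgebra.
Variables (K : fieldType) (A : localAlgType K).
Local Notation m := (\m_A).
Let m_ideal : is_ideal m := maxideal_ideal A.

Definition rees_pred : {pred {poly A}} :=
  fun p => all (fun i => p`_i \in ideal_exp m i) (iota 0 (size p)).

Lemma rees_predP (p : {poly A}) :
  reflect (forall i, p`_i \in ideal_exp m i) (p \in rees_pred).
Proof.
apply: (iffP allP) => [H i|H i _]; last exact: H.
case: (ltnP i (size p)) => lti; first by apply: H; rewrite mem_iota.
by rewrite nth_default ?mem0v.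
Qed.

Lemma rees_subring : subring_closed rees_pred.
Proof.
split=> [|p q /rees_predP Hp /rees_predP Hq|p q /rees_predP Hp /rees_predP Hq].
- apply/rees_predP => -[|i]; first exact: memvf.
  by rewrite coef1 mem0v.
- by apply/rees_predP => i; rewrite coefB rpredB.
- apply/rees_predP => i; rewrite coefM; apply: rpred_sum => l _.
  have := ideal_expM m_ideal (Hp l) (Hq (i - l)%N).
  by rewrite subnKC // -ltnS.
Qed.
HB.instance Definition _ :=
  GRing.isSubringClosed.Build {poly A} rees_pred rees_subring.

Record rees := Rees { rees_val :> {poly A}; _ : rees_val \in rees_pred }.
HB.instance Definition _ := [isSub for rees_val].
HB.instance Definition _ := [Choice of rees by <:].
HB.instance Definition _ := [SubChoice_isSubComNzRing of rees by <:].

Lemma reesP (p : rees) i : (p : {poly A})`_i \in ideal_exp m i.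
Proof. by case: p => p Hp /=; apply/rees_predP. Qed.

Lemma rees_scale_subproof (c : K) (p : rees) :
  c%:A *: (p : {poly A}) \in rees_pred.
Proof.
apply/rees_predP => i; rewrite coefZ mulr_algl rpredZ //; exact: reesP.
Qed.
Definition rees_scale c p : rees := Rees (rees_scale_subproof c p).

Lemma rees_scaleA c d p : rees_scale c (rees_scale d p) = rees_scale (c * d) p.
Proof. by apply: val_inj; rewrite /= scalerA mulr_algl scalerA. Qed.

Lemma rees_scale1 : left_id 1 rees_scale.
Proof. by move=> p; apply: val_inj; rewrite /= !scale1r. Qed.

Lemma rees_scaleDr : right_distributive rees_scale +%R.
Proof. by move=> c p q; apply: val_inj; rewrite /= scalerDr. Qed.

Lemma rees_scaleDl p : {morph rees_scale^~ p : c d / c + d}.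
Proof. by move=> c d; apply: val_inj; rewrite /= !scalerDl. Qed.

HB.instance Definition _ := GRing.Zmodule_isLmodule.Build K rees
  rees_scaleA rees_scale1 rees_scaleDr rees_scaleDl.

Lemma rees_scaleAl (c : K) (p q : rees) : c *: (p * q) = (c *: p) * q.
Proof. by apply: val_inj; rewrite /= scalerAl. Qed.

HB.instance Definition _ := GRing.Lmodule_isLalgebra.Build K rees rees_scaleAl.
HB.instance Definition _ := GRing.Lalgebra_isComAlgebra.Build K rees.

Lemma coef_reesD (p q : rees) i :
  ((p + q : rees) : {poly A})`_i = (p : {poly A})`_i + (q : {poly A})`_i.
Proof. exact: coefD. Qed.

Lemma coef_reesB (p q : rees) i :
  ((p - q : rees) : {poly A})`_i = (p : {poly A})`_i - (q : {poly A})`_i.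
Proof. exact: coefB. Qed.

Lemma coef_reesM (p q : rees) i : ((p * q : rees) : {poly A})`_i =
  \sum_(l < i.+1) (p : {poly A})`_l * (q : {poly A})`_(i - l).
Proof. exact: coefM. Qed.

(* The kernel of the projection of the Rees algebra onto \bigoplus_i m^i/m^i+1. *)
Definition rees_shift : {pred rees} :=
  fun p => all (fun i => (p : {poly A})`_i \in ideal_exp m i.+1)
               (iota 0 (size (p : {poly A}))).

Lemma rees_shiftP (p : rees) :
  reflect (forall i, (p : {poly A})`_i \in ideal_exp m i.+1) (p \in rees_shift).
Proof.
apply: (iffP allP) => [H i|H i _]; last exact: H.
case: (ltnP i (size (p : {poly A}))) => lti; first by apply: H; rewrite mem_iota.
by rewrite nth_default ?mem0v.
Qed.

Lemma rees_shift_ideal : idealr_closed rees_shift.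
Proof.
split=> [||a p q /rees_shiftP Hp /rees_shiftP Hq].
- by apply/rees_shiftP => i; rewrite coef0 mem0v.
- apply/negP => /rees_shiftP /(_ 0%N); rewrite coef1 /ideal_exp expv1.
  exact/negP/one_notin_maxideal.
- apply/rees_shiftP => i; rewrite coef_reesD coef_reesM rpredD //.
  apply: rpred_sum => l _.
  have := ideal_expM m_ideal (reesP a l) (Hp (i - l)%N).
  by rewrite addnS subnKC // -ltnS.
Qed.
HB.instance Definition _ := isIdealr.Build rees rees_shift rees_shift_ideal.

End ReesAlgebra.

Section SymmetricDecomposition.
Variables (K : fieldType) (A : localAlgType K).
Local Notation m := (\m_A).
Local Notation j := (socle_degree A).
Let m_ideal : is_ideal m := maxideal_ideal A.

(* Gr_m(A) = \bigoplus_i m^i/m^i+1, with its K-algebra structure. *)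
Definition assoc_graded := {ideal_quot (@rees_shift K A)}.
HB.instance Definition _ := GRing.ComAlgebra.on assoc_graded.

Definition gr_class (p : rees A) : assoc_graded :=
  \pi_{ideal_quot (@rees_shift K A)} p.

(* A class of Gr_m(A) lies in C_A(a) when its degree i component is represented
   by an element of m^i killed by m^(j+1-a-i); the truncated subtraction and
   ideal_exp _ 0 = fullv implement the convention m^s = A for s <= 0. On an
   arbitrary representative this reads modulo m^i+1; see iarrobinoP. *)
Definition iarrobino_deg (a i : nat) : {vspace A} :=
  (ideal_exp m i :&: annihilator (ideal_exp m (j.+1 - a - i)))%VS.

Definition iarrobino (a : nat) : {pred assoc_graded} :=
  fun x => let p : {poly A} := repr x : rees A in
    all (fun i => p`_i \in (iarrobino_deg a i + ideal_exp m i.+1)%VS)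
        (iota 0 (size p)).

Lemma gr_classE (p q : rees A) :
  gr_class p = gr_class q <->
  forall i, (p : {poly A})`_i - (q : {poly A})`_i \in ideal_exp m i.+1.
Proof.
rewrite /gr_class; split=> [/eqP|H].
  by rewrite -Quotient.idealrBE => /rees_shiftP H i; rewrite -coef_reesB.
apply/eqP; rewrite -Quotient.idealrBE; apply/rees_shiftP => i.
by rewrite coef_reesB.
Qed.

Lemma gr_class_repr (x : assoc_graded) : gr_class (repr x) = x.
Proof. exact: reprK. Qed.

Lemma iarrobino_class a (p : rees A) :
  reflect (forall i, (p : {poly A})`_i \in
             (iarrobino_deg a i + ideal_exp m i.+1)%VS)
          (gr_class p \in iarrobino a).
Proof.
have /gr_classE E := gr_class_repr (gr_class p).
set q := repr (gr_class p) in E.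
have Eq i : ((p : {poly A})`_i \in (iarrobino_deg a i + ideal_exp m i.+1)%VS) =
            ((q : {poly A})`_i \in (iarrobino_deg a i + ideal_exp m i.+1)%VS).
  rewrite -[X in _ = (X \in _)](subrK (p : {poly A})`_i) rpredDl //.
  exact: subvP (addvSr _ _) _ (E i).
apply: (iffP allP) => [H i|H i _]; last by rewrite -Eq.
rewrite Eq; case: (ltnP i (size (q : {poly A}))) => lti.
  by apply: H; rewrite mem_iota.
by rewrite nth_default ?mem0v.
Qed.

Lemma iarrobinoP a (x : assoc_graded) :
  reflect (exists2 p : rees A, x = gr_class p &
             forall i, (p : {poly A})`_i \in iarrobino_deg a i)
          (x \in iarrobino a).
Proof.
apply: (iffP idP) => [|[p -> H]]; last first.
  by apply/iarrobino_class => i; apply: subvP (addvSl _ _) _ (H i).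
rewrite -[x]gr_class_repr => /iarrobino_class; move: (repr x) => q H.
pose p0 := \poly_(i < size (q : {poly A}))
  addv_pi1 (iarrobino_deg a i) (ideal_exp m i.+1) (q : {poly A})`_i.
have p0E i : p0`_i =
    addv_pi1 (iarrobino_deg a i) (ideal_exp m i.+1) (q : {poly A})`_i.
  rewrite coef_poly; case: ltnP => // lti.
  by rewrite [(q : {poly A})`_i]nth_default // linear0.
have p0P : p0 \in @rees_pred K A.
  apply/rees_predP => i; rewrite p0E.
  exact: subvP (capvSl _ _) _ (memv_pi1 _ _ _).
exists (Rees p0P) => [|i]; last by rewrite p0E memv_pi1.
apply/gr_classE => i; rewrite p0E.
by rewrite -{1}(addv_pi1_pi2 (H i)) addrC addKr memv_pi2.
Qed.

Lemma iarrobino_deg_ideal a i l x y : x \in ideal_exp m l ->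
  y \in (iarrobino_deg a i + ideal_exp m i.+1)%VS ->
  x * y \in (iarrobino_deg a (l + i) + ideal_exp m (l + i).+1)%VS.
Proof.
move=> xl /memv_addP[u /[!memv_cap]/andP[ui /annihilatorP uann] [v vi ->]].
rewrite mulrDr memv_add //; last first.
  by rewrite -addnS; apply: ideal_expM.
rewrite memv_cap ideal_expM //=; apply/annihilatorP => w wI.
rewrite -mulrA mulrCA (mulrC x); apply: uann.
apply: subvP (ideal_exp_le m_ideal _) _ (ideal_expM m_ideal wI xl).
by rewrite [(l + i)%N]addnC subnDA addnC -maxnE leq_maxr.
Qed.

Lemma iarrobino0 (x : assoc_graded) : x \in iarrobino 0.
Proof.
apply/iarrobinoP; exists (repr x) => [|i]; first by rewrite gr_class_repr.
rewrite memv_cap reesP; apply/annihilatorP => w wI.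
have := ideal_expM m_ideal (reesP (repr x) i) wI; rewrite subn0 -maxnE.
move/(subvP (ideal_exp_le m_ideal (leq_maxr i _))).
have [->|/(socle_degree_max A).2] := eqVneq (ideal_exp m j.+1) 0%VS.
  by rewrite memv0 => /eqP.
by rewrite ltnn.
Qed.

(* C_A(0) is the unit ideal by iarrobino0, so only C_A(a) with a > 0 is proper. *)
Lemma iarrobino_ideal a : idealr_closed (iarrobino a.+1).
Proof.
split=> [||x y z].
- have -> : 0 = gr_class 0 by rewrite /gr_class rmorph0.
  apply/iarrobino_class => i.
  by rewrite coef0 mem0v.
- have -> : 1 = gr_class 1 by rewrite /gr_class rmorph1.
  apply/negP => /iarrobino_class /(_ 0%N).
  rewrite coef1 /= expv1 => H; case/negP: (one_notin_maxideal A).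
  apply: subvP H; rewrite subv_add subvv andbT.
  apply: subv_trans (capvSr _ _) _; apply: ideal_sub_maxideal.
    exact: annihilator_ideal.
  apply: contra (socle_degree_max A).1 => /eqP E.
  rewrite eqEsubv sub0v andbT; apply/subvP => w wj.
  rewrite memv0 -[w]mul1r; apply/eqP; move: (memvf (1 : A)); rewrite -E.
  move=> /annihilatorP; apply; apply: subvP wj; apply: ideal_exp_le => //.
  by rewrite subn0 subSS leq_subr.
- rewrite -[x]gr_class_repr -[y]gr_class_repr -[z]gr_class_repr.
  move: (repr x) (repr y) (repr z) => p q r /iarrobino_class Hq /iarrobino_class Hr.
  have -> : gr_class p * gr_class q + gr_class r = gr_class (p * q + r).
    by rewrite /gr_class rmorphD rmorphM.
  apply/iarrobino_class => i; rewrite coef_reesD coef_reesM rpredD //.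
  apply: rpred_sum => l _.
  have := iarrobino_deg_ideal (reesP p l) (Hq (i - l)%N).
  by rewrite subnKC // -ltnS.
Qed.
HB.instance Definition _ a :=
  isIdealr.Build assoc_graded (iarrobino a.+1) (iarrobino_ideal a).

(* Q_A(0) = C_A(0)/C_A(1) = Gr_m(A)/C_A(1). *)
Definition first_quotient := {ideal_quot (iarrobino 1)}.
HB.instance Definition _ := GRing.ComAlgebra.on first_quotient.

End SymmetricDecomposition.

Section Smoothable.
Variables (K : fieldType) (N : nat).
Local Notation S := {mpoly K[N]}.

Definition ideal_pred (I : S -> Prop) : Prop :=
  [/\ I 0, forall p q, I p -> I q -> I (p + q) & forall p q, I q -> I (p * q)].

(* The classes of b_0, ..., b_(n-1) form a K-basis of S/I. *)
Definition basis_mod (n : nat) (I : S -> Prop) (b : 'I_n -> S) : Prop :=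
  forall p, exists! c : 'rV[K]_n, I (p - \sum_i c 0 i *: b i).

(* The K-points of Hilb^n(A^N). *)
Record hilb (n : nat) := Hilb {
  hilb_ideal :> S -> Prop;
  hilb_ideal_pred : ideal_pred hilb_ideal;
  hilb_colength : exists b : 'I_n -> S, basis_mod hilb_ideal b
}.

(* For monomials b_0, ..., b_(n-1), the points I such that b is a basis of S/I
   form an affine chart of the Hilbert scheme; its coordinate ring is generated
   by the coefficients c_(m,i)(I) in x^m = \sum_i c_(m,i)(I) b_i mod I, for all
   monomials m.  Given finitely many monomials w_0, ..., w_(r-1) and a
   polynomial f, principal_open b w f is the locus of the chart where the
   regular function f((c_(w_l,i))_(l,i)) does not vanish. These loci form a
   basis of the Zariski topology. *)
Definition principal_open n (b : 'I_n -> 'X_{1..N}) r (w : 'I_r -> 'X_{1..N})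
    (f : {mpoly K[r * n]}) (I : hilb n) : Prop :=
  basis_mod I (fun i => 'X_[b i]) /\
  exists c : 'M[K]_(r, n),
    (forall l, I ('X_[w l] - \sum_i c l i *: 'X_[b i])) /\
    f.@[mxvec c 0] != 0.

Definition zariski_open n (U : hilb n -> Prop) : Prop :=
  forall I, U I -> exists b r (w : 'I_r -> 'X_{1..N}) (f : {mpoly K[r * n]}),
    principal_open b w f I /\ (forall J, principal_open b w f J -> U J).

Definition zariski_closure n (Z : hilb n -> Prop) (I : hilb n) : Prop :=
  forall U, zariski_open U -> U I -> exists J, U J /\ Z J.

Definition reduced n (I : hilb n) : Prop :=
  forall (p : S) (e : nat), I (p ^+ e) -> I p.

End Smoothable.

(* phi is the comorphism of a closed embedding of Spec B in A^N, and I its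
   kernel, whose colength n is the length of B. *)
Definition smoothable (K : fieldType) (B : comAlgType K) : Prop :=
  exists (N n : nat) (phi : {lrmorphism {mpoly K[N]} -> B}) (I : hilb K N n),
    [/\ forall y, exists p, phi p = y,
        forall p, I p <-> phi p = 0 &
        zariski_closure (@reduced K N n) I].

(* Main.v *)
From HB Require Import structures.
Require Import Defs.
From mathcomp Require Import all_boot all_order all_algebra falgebra.
From mathcomp Require Import generic_quotient ring_quotient.
From mathcomp.multinomials Require Import mpoly.
From mathcomp Require Import ring zify.

Set Implicit Arguments.
Unset Strict Implicit.
Unset Printing Implicit Defensive.

Import GRing.Theory.
Local Open Scope ring_scope.

(** The algebra is apolar to the divided power polynomial x^[4] + G(y), where G
    is a sufficiently general cubic in 13 variables.  It has the basis
    1, x, ..., x^4, y_1, ..., y_13, Y_1, ..., Y_13, with x y_i = x Y_i = 0,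
    y_i y_j = sum_k G_ijk Y_k and y_i Y_j = delta_ij x^4, so that its length
    is 5 + 13 + 13 = 31.  The powers of x and the pairs (y_i, Y_i) are dual to
    each other under the product with values in the socle x^4, hence the
    algebra is Gorenstein ([apolar_gorenstein]).  When the matrix (G_iik) is
    invertible the Y_k lie in m^2, and the embedding dimension is 1 + 13
    ([apolar_embdim]).

    Not smoothable.  Let sigma be a linear functional whose value at x^4 is 1,
    so that sigma(y_i y_j y_k) = G_ijk.  A reduced algebra of length 31 over an
    algebraically closed field is a product of copies of the field, so that in
    it every linear functional has the form sum_q s_q ev_q, and the trilinear
    form sigma(a b c) on 13 elements is a sum of 31 weighted cubes
    ([reduced_cubic_form]).  Such sums depend on 31 * 14 = 434 parameters,
    whereas a cubic form in 13 variables has 455 coefficients; hence a nonzero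
    polynomial P vanishes at all of them ([algebraic_dependence],
    [secant_equation]).  The coefficients of the form sigma(a b c) are regular
    functions on a chart of the Hilbert scheme, so P yields a closed condition
    that holds on the closure of the reduced locus, and a cubic G with
    P(G) != 0 violates it ([not_smoothable_apolar]).  As the field is infinite,
    G can be chosen with P(G) != 0 and (G_iik) invertible ([generic_cubic]).

    The first symmetric quotient.  The classes of the y_i are killed by m^3 and
    those of the Y_i by m^2, while the product of x^i and x^(4 - i) is not zero.
    Thus C(1) is spanned by the classes of the y_i and Y_i, and Q(0) is
    K[x]/x^5 ([gr_class_iarrobino1]).  This fat point is the limit for t -> 0 of
    the reduced points t a_1, ..., t a_5 of the affine line
    ([fat_point_closure]). *)

(** * Nonvanishing and algebraic dependence of polynomials *)

Lemma poly_nonroot (K : closedFieldType) (p : {poly K}) :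
  p != 0 -> exists x, p.[x] != 0.
Proof.
move=> p0; have [/size1_polyC E|s1] := leqP (size p) 1.
  by exists 0; rewrite E hornerC -polyC_eq0 -E.
(* A nonconstant p takes the value 1. *)
have sz : size (p - 1) != 1%N by rewrite size_polyDl ?size_polyN ?size_poly1 // gtn_eqF.
have /closed_rootP[x] := sz.
rewrite /root hornerD hornerN hornerC subr_eq0 => /eqP E.
by exists x; rewrite E oner_neq0.
Qed.

Lemma base_expansion_inj D r (a b : nat -> nat) :
  (forall i, (i < r)%N -> (a i < D)%N) -> (forall i, (i < r)%N -> (b i < D)%N) ->
  (\sum_(i < r) a i * D ^ i = \sum_(i < r) b i * D ^ i)%N ->
  forall i, (i < r)%N -> a i = b i.
Proof.
elim: r a b => [|r IH] a b aD bD // E.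
have D0 : (0 < D)%N by apply: leq_ltn_trans (aD 0%N isT).
have step (c : nat -> nat) : (\sum_(i < r.+1) c i * D ^ i =
    (\sum_(i < r) c i.+1 * D ^ i) * D + c 0)%N.
  rewrite big_ord_recl expn0 muln1 addnC big_distrl /=; congr (_ + _)%N.
  by apply: eq_bigr => i _; rewrite expnSr mulnA.
move: E; rewrite !step => E.
have E0 : a 0%N = b 0%N.
  have := congr1 (modn^~ D) E.
  by rewrite /= !modnMDl !modn_small ?aD ?bD.
move=> [|i] //; rewrite ltnS => ir.
apply: (IH (a \o succn) (b \o succn)) => // [l lr|l lr|]; [exact: aD|exact: bD|].
by move/eqP: E; rewrite E0 eqn_add2r eqn_pmul2r // => /eqP.
Qed.

(** Kronecker substitution: for D larger than all exponents of P, replacing the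
    variable i by t ^ (D ^ i) turns distinct monomials of P into distinct powers
    of t, which reduces the claim to one variable. *)
Lemma mpoly_nonroot (K : closedFieldType) r (P : {mpoly K[r]}) :
  P != 0 -> exists v : 'I_r -> K, P.@[v] != 0.
Proof.
move=> P0; pose D := msize P.
have ltD m i : m \in msupp P -> (nth 0%N m i < D)%N.
  move=> /msize_mdeg_lt; apply: leq_ltn_trans.
  have [ir|ir] := ltnP i r; last by rewrite nth_default ?size_tuple.
  rewrite mdegE (bigD1 (Ordinal ir)) //= (mnm_nth 0%N).
  exact: leq_addr.
pose kr (m : 'X_{1..r}) := (\sum_(i < r) m i * D ^ i)%N.
have krE (m : 'X_{1..r}) : kr m = (\sum_(i < r) nth 0 m i * D ^ i)%N.
  by apply: eq_bigr => i _; rewrite (mnm_nth 0%N).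
have kr_inj : {in msupp P &, injective kr}.
  move=> m m' mP mP' E; apply/mnmP => i; rewrite !(mnm_nth 0%N).
  apply: (base_expansion_inj (D := D) (r := r)); rewrite ?ltn_ord -?krE //.
    by move=> l _; apply: ltD.
  by move=> l _; apply: ltD.
pose g := \sum_(m <- msupp P) P@_m *: 'X^(kr m) : {poly K}.
have gE t : g.[t] = P.@[fun i => t ^+ (D ^ i)].
  rewrite mevalE horner_sum; apply: eq_bigr => m _.
  rewrite hornerZ hornerXn; congr (_ * _).
  by rewrite expr_sum; apply: eq_bigr => i _; rewrite -exprM mulnC.
have g0 : g != 0.
  have lP : mlead P \in msupp P by apply: mlead_supp.
  apply/eqP => /(congr1 (fun q : {poly K} => q`_(kr (mlead P)))).
  rewrite coef0 coef_sum (bigD1_seq (mlead P)) ?msupp_uniq //=.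
  rewrite coefZ coefXn eqxx mulr1 big1_seq ?addr0.
    by apply/eqP; rewrite mleadc_eq0.
  move=> m /andP[nm mP]; rewrite coefZ coefXn.
  case: eqP => [/kr_inj E|]; last by rewrite mulr0.
  by rewrite E // eqxx in nm.
have [t gt] := poly_nonroot g0.
by exists (fun i => t ^+ (D ^ i)); rewrite -gE.
Qed.

Definition mdeg_le (K : nzRingType) m d (p : {mpoly K[m]}) := (msize p <= d.+1)%N.

Lemma mdeg_leM (K : idomainType) m d e (p q : {mpoly K[m]}) :
  mdeg_le d p -> mdeg_le e q -> mdeg_le (d + e) (p * q).
Proof.
rewrite /mdeg_le => Hp Hq; have [->|p0] := eqVneq p 0; first by rewrite mul0r msize0.
have [->|q0] := eqVneq q 0; first by rewrite mulr0 msize0.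
rewrite msizeM //; case: (msize q) Hq => [|s] Hq.
  by rewrite addn0 (leq_trans (leq_pred _)) // (leq_trans Hp) // ltnS leq_addr.
by rewrite addnS /= -addSn leq_add.
Qed.

Lemma mdeg_leX (K : idomainType) m d e (p : {mpoly K[m]}) :
  mdeg_le d p -> mdeg_le (e * d) (p ^+ e).
Proof.
move=> Hp; elim: e => [|e IH]; first by rewrite /mdeg_le expr0 msize1.
by rewrite exprS mulSn mdeg_leM.
Qed.

(** Counting.  Consider the D ^ r monomials in the f_i with all exponents below
    D.  With d bounding the degrees of the f_i, they are combinations of
    monomials in m variables with exponents at most r d D, of which there are
    about (r d D) ^ m; this is less than D ^ r for large D because m < r, so a
    nontrivial combination of the former vanishes. *)
Lemma algebraic_dependence (K : fieldType) m r (f : 'I_r -> {mpoly K[m]}) :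
  (m < r)%N ->
  exists2 P : {mpoly K[r]}, P != 0 &
    forall a : 'I_m -> K, P.@[fun t => (f t).@[a]] = 0.
Proof.
move=> mr; pose d := (\max_t msize (f t))%N.
have fd t : mdeg_le d (f t) by rewrite /mdeg_le leqW // leq_bigmax.
(* This D satisfies (r d D + 1) ^ m <= (r d + 1) ^ m * D ^ m < D ^ m.+1. *)
pose D := ((r * d).+1 ^ m).+1; pose E := (r * d * D).+1.
pose S := {ffun 'I_r -> 'I_D}; pose T := {ffun 'I_m -> 'I_E}.
pose mS (s : S) : 'X_{1..r} := [multinom (s i : nat) | i < r].
pose mT (s : T) : 'X_{1..m} := [multinom (s i : nat) | i < m].
pose F (s : S) := \prod_i f i ^+ s i.
pose M := \matrix_(s < #|S|, t < #|T|) (F (enum_val s))@_(mT (enum_val t)).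
have ltTS : (#|T| < #|S|)%N.
  rewrite !card_ffun !card_ord.
  have DE : (E <= (r * d).+1 * D)%N by rewrite mulSn /E -add1n leq_add2r.
  apply: (@leq_ltn_trans ((r * d).+1 ^ m  * D ^ m)).
    by rewrite -expnMn; case: (m) => [|m']; rewrite ?expn0 ?leq_exp2r.
  apply: (@leq_trans (D ^ m.+1)); last by rewrite leq_pexp2l.
  by rewrite expnS ltn_pmul2r ?expn_gt0.
have [u uM u0] : exists2 u : 'rV_#|S|, u *m M = 0 & u != 0.
  have: kermx M != 0.
    by rewrite kermx_eq0 /row_free neq_ltn (leq_ltn_trans (rank_leq_col M)).
  by case/rowV0Pn => u /sub_kermxP uM u0; exists u.
pose P : {mpoly K[r]} := \sum_s u 0 s *: 'X_[mS (enum_val s)].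
have mS_inj : injective mS.
  move=> s s' /mnmP E'; apply/ffunP => i; apply: val_inj.
  by have := E' i; rewrite !mnmE.
have Pc s : P@_(mS (enum_val s)) = u 0 s.
  rewrite raddf_sum (bigD1 s) //= mcoeffZ mcoeffX eqxx mulr1 big1 ?addr0 //.
  move=> s' ns; rewrite mcoeffZ mcoeffX (inj_eq mS_inj) (inj_eq enum_val_inj).
  by rewrite (negPf ns) mulr0.
exists P.
  apply: contra u0 => /eqP P0; apply/eqP/rowP => s.
  by rewrite -Pc P0 mcoeff0 mxE.
move=> a; pose Q := \sum_s u 0 s *: F (enum_val s).
suff Q0 : Q = 0.
  rewrite raddf_sum -[RHS](meval0 a) -Q0 raddf_sum; apply: eq_bigr => s _ /=.
  rewrite !mevalZ mevalX rmorph_prod; congr (_ * _); apply: eq_bigr => i _.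
  by rewrite rmorphXn /= mnmE.
apply/mpolyP => k; rewrite mcoeff0 raddf_sum /=.
have [/existsP[i ki]|] := boolP [exists i, E <= k i]%N.
  rewrite big1 // => s _; rewrite mcoeffZ memN_msupp_eq0 ?mulr0 //.
  apply: contraL ki => /msize_mdeg_lt ks; rewrite -ltnNge.
  apply: (@leq_ltn_trans (mdeg k)); first by rewrite mdegE (bigD1 i) //= leq_addr.
  suff: mdeg_le (r * d * D) (F (enum_val s)) by apply: leq_trans.
  have: mdeg_le (\sum_(i < r) enum_val s i * d) (F (enum_val s)).
    rewrite /F; elim/big_ind2: _ => [|x p y q|l _]; first by rewrite /mdeg_le msize1.
      exact: mdeg_leM.
    exact: mdeg_leX.
  rewrite /mdeg_le => /leq_trans; apply; rewrite ltnS mulnAC -big_distrl /= leq_mul2r.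
  apply/orP; right; apply: (@leq_trans (\sum_(l < r) D)).
    by apply: leq_sum => l _; apply/ltnW/ltn_ord.
  by rewrite sum_nat_const card_ord.
rewrite negb_exists => /forallP kE.
have kl i : (k i < E)%N by rewrite ltnNge.
pose t : T := [ffun i => Ordinal (kl i)].
have kt : k = mT (enum_val (enum_rank t)).
  by apply/mnmP => i; rewrite enum_rankK mnmE ffunE.
have /rowP/(_ (enum_rank t)) := uM; rewrite !mxE => uMt.
rewrite -[RHS]uMt; apply: eq_bigr => s _.
by rewrite mcoeffZ mxE -kt.
Qed.

(** * Coordinates and multiplication matrices at a point of the Hilbert scheme *)

Section Coordinates.
Variables (K : fieldType) (N n : nat) (J : hilb K N n).
Local Notation S := {mpoly K[N]}.
Variable b : 'I_n -> S.
Hypothesis basisJ : basis_mod J b.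

Definition coords (p : S) (r : 'rV[K]_n) : Prop := J (p - \sum_i r 0 i *: b i).

Lemma hilb0 : J 0. Proof. by have [] := hilb_ideal_pred J. Qed.
Lemma hilbD p q : J p -> J q -> J (p + q).
Proof. by have [_ H _] := hilb_ideal_pred J; apply: H. Qed.
Lemma hilbM p q : J q -> J (p * q).
Proof. by have [_ _ H] := hilb_ideal_pred J; apply: H. Qed.
Lemma hilbZ s p : J p -> J (s *: p).
Proof. by rewrite -mul_mpolyC; apply: hilbM. Qed.
Lemma hilb_sum (I : finType) (F : I -> S) : (forall i, J (F i)) -> J (\sum_i F i).
Proof. by move=> H; elim/big_ind: _ => //; [exact: hilb0|exact: hilbD]. Qed.

Lemma coords_exists p : exists r, coords p r.
Proof. by have [r [Hr _]] := basisJ p; exists r. Qed.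

Lemma coords_uniq p r s : coords p r -> coords p s -> r = s.
Proof. by have [t [_ H]] := basisJ p; move=> /H <- /H <-. Qed.

Lemma coordsD p q r s : coords p r -> coords q s -> coords (p + q) (r + s).
Proof.
rewrite /coords => Hp Hq; have := hilbD Hp Hq.
rewrite addrACA -opprD -big_split /=; congr (J (_ - _)).
by apply: eq_bigr => i _; rewrite mxE scalerDl.
Qed.

Lemma coordsZ s p r : coords p r -> coords (s *: p) (s *: r).
Proof.
rewrite /coords => /(hilbZ s); rewrite scalerBr scaler_sumr; congr (J (_ - _)).
by apply: eq_bigr => i _; rewrite mxE scalerA.
Qed.

Lemma coords0 p : coords p 0 <-> J p.
Proof.
rewrite /coords big1 ?subr0 // => i _.
by rewrite mxE scale0r.
Qed.

Lemma coords_basis l : coords (b l) (delta_mx 0 l).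
Proof.
rewrite /coords (bigD1 l) //= big1 ?addr0 => [|i il].
  by rewrite mxE !eqxx scale1r subrr; apply: hilb0.
by rewrite mxE (negPf il) andbF scale0r.
Qed.

Definition mult_mx (y : S) (R : 'M[K]_n) : Prop :=
  forall l, coords (y * b l) (row l R).

Lemma mult_mx_exists y : exists R, mult_mx y R.
Proof.
have [f fP] := fin_all_exists (fun l => coords_exists (y * b l)).
by exists (\matrix_l f l) => l; rewrite rowK.
Qed.

Lemma coordsM y R p r : mult_mx y R -> coords p r -> coords (y * p) (r *m R).
Proof.
move=> yR pr.
have H : J (y * p - \sum_i r 0 i *: (y * b i)).
  have := hilbM y pr; rewrite mulrBr mulr_sumr; congr (J (_ - _)).
  by apply: eq_bigr => i _; rewrite scalerAr.
have := hilbD H (hilb_sum (fun i => hilbZ (r 0 i) (yR i))).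
have -> : \sum_i r 0 i *: (y * b i - \sum_j row i R 0 j *: b j) =
    \sum_i r 0 i *: (y * b i) - \sum_j (r *m R) 0 j *: b j.
  under eq_bigr do rewrite scalerBr scaler_sumr.
  rewrite sumrB exchange_big; congr (_ - _); apply: eq_bigr => j _.
  by rewrite mxE scaler_suml; apply: eq_bigr => i _; rewrite mxE scalerA.
by rewrite addrA subrK.
Qed.

Lemma mult_mx_comm y z R T : mult_mx y R -> mult_mx z T -> R *m T = T *m R.
Proof.
move=> yR zT; apply/row_matrixP => l; rewrite !row_mul.
apply: (@coords_uniq (z * y * b l)).
  by rewrite -mulrA; apply: coordsM.
by rewrite [z * y]mulrC -mulrA; apply: coordsM.
Qed.

End Coordinates.

Section Reduced.
Variables (K : closedFieldType) (N n' : nat).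
Let n := n'.+1.
Variable J : hilb K N n.
Local Notation S := {mpoly K[N]}.
Variable b : 'I_n -> S.
Hypothesis basisJ : basis_mod J b.

Lemma mult_mx_horner y (R : 'M[K]_n) (q : {poly K}) :
  mult_mx J b y R -> mult_mx J b (horner_alg y q) (horner_mx R q).
Proof.
move=> yR; elim/poly_ind: q => [|q s IH] l.
  by rewrite !rmorph0 mul0r row0; apply/coords0/hilb0.
rewrite rmorphD rmorphM /= horner_algX horner_algC mulrDl.
rewrite rmorphD rmorphM /= horner_mx_X horner_mx_C linearD /=.
apply: coordsD.
  by rewrite [_ * y]mulrC -mulrA -mulmxE row_mul; apply: coordsM.
rewrite mulr_algl -scalemx1 linearZ /= row1.
by apply: coordsZ; apply: coords_basis.
Qed.

(** The radical of the minimal polynomial of R, evaluated at y, is nilpotent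
    modulo J, hence lies in J; so the minimal polynomial of R has no multiple
    root. *)
Lemma reduced_diagonalizable y (R : 'M[K]_n) :
  reduced J -> mult_mx J b y R -> diagonalizable R.
Proof.
move=> redJ yR; apply/diagonalizableP.
have [rs Ers] := closed_field_poly_normal (mxminpoly R).
pose rad := \prod_(z <- undup rs) ('X - z%:P).
exists (undup rs); first exact: undup_uniq.
apply: mxminpoly_min; rewrite -/rad.
have dvd : mxminpoly R %| rad ^+ size rs.
  rewrite Ers (monicP (mxminpoly_monic R)) scale1r.
  have: {subset rs <= undup rs} by move=> z; rewrite mem_undup.
  elim: {1 3 4}rs => [|z s IH] sub; first by rewrite big_nil expr0 dvdpp.
  rewrite big_cons exprS dvdp_mul ?IH //; last by move=> x xs; rewrite sub // inE xs orbT.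
  by rewrite /rad (big_rem z) ?sub ?mem_head //= dvdp_mulr.
have Jrad : J (horner_alg y rad).
  apply: (redJ _ (size rs)); rewrite -rmorphXn.
  have [e He] := coords_exists basisJ 1.
  have := coordsM (mult_mx_horner (rad ^+ size rs) yR) He.
  rewrite mulr1 (_ : horner_mx R _ = 0) ?mulmx0 => [/coords0 //|].
  by case/dvdpP: dvd => q ->; rewrite rmorphM /= mx_root_minpoly mulr0.
apply/row_matrixP => l; rewrite row0.
apply: (coords_uniq basisJ (mult_mx_horner rad yR l)).
by apply/coords0; rewrite mulrC; apply: hilbM.
Qed.

End Reduced.

(** The multiplication matrices of the y_i are simultaneously diagonalizable,
    and a q i is the q-th eigenvalue of y_i, that is, its value at the q-th
    point.  In an eigenbasis the functional phi becomes a sum of evaluations,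
    up to the weights s q. *)
Lemma reduced_cubic_form (K : closedFieldType) (N n c : nat) (J : hilb K N n)
    (b : 'I_n -> {mpoly K[N]}) (phi : 'I_n -> K) (y : 'I_c -> {mpoly K[N]}) :
  reduced J -> basis_mod J b ->
  exists (s : 'I_n -> K) (a : 'I_n -> 'I_c -> K), forall i j k r,
    coords J b (y i * y j * y k) r ->
    \sum_l r 0 l * phi l = \sum_q s q * (a q i * a q j * a q k).
Proof.
case: n J b phi => [|n] J b phi redJ basisJ.
  by exists (fun=> 0), (fun _ _ => 0) => i j k r _; rewrite !big_ord0.
have [R yR] := fin_all_exists (fun i => mult_mx_exists basisJ (y i)).
have : codiagonalizable [seq R i | i <- enum 'I_c].
  apply/codiagonalizableP; split.
    move=> _ _ /mapP[i _ ->] /mapP[j _ ->].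
    exact: (mult_mx_comm basisJ (yR i) (yR j)).
  move=> _ /mapP[i _ ->]; exact: (reduced_diagonalizable basisJ redJ (yR i)).
case=> P Punit /allP Pdiag.
have /fin_all_exists[d dP] : forall i, exists d, R i = invmx P *m diag_mx d *m P.
  move=> i; have /Pdiag : R i \in [seq R i | i <- enum 'I_c].
    by rewrite map_f ?mem_enum.
  by case/(diagonalizable_forLR Punit) => d ->; exists d; rewrite mxpoly.conjVmx.
have [e He] := coords_exists basisJ 1.
pose f := P *m \col_l phi l.
exists (fun q => (e *m invmx P) 0 q * f q 0), (fun q i => d i 0 q) => i j k r Hr.
have Er : r = e *m (invmx P *m (diag_mx (d k) *m diag_mx (d j) *m diag_mx (d i)) *m P).
  apply: (coords_uniq basisJ Hr).
  rewrite (_ : invmx P *m _ *m P = R k *m R j *m R i); last first.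
    by rewrite !dP !mulmxA !(mulmxK Punit).
  rewrite -mulrA -[y j * y k]mulr1 -mulrA !mulmxA.
  by do 3!apply: coordsM => //.
transitivity ((r *m \col_l phi l) 0 0).
  by rewrite mxE; apply: eq_bigr => l _; rewrite mxE.
rewrite Er !mulmx_diag !mulmxA -(mulmxA _ P) -/f mxE.
apply: eq_bigr => q _; rewrite mul_mx_diag !mxE; ring.
Qed.

(** * Presentations of an algebra by a point of the Hilbert scheme *)
Section Presentation.
Variables (K : fieldType) (B : comFalgType K) (N n : nat).
Variables (phi : {lrmorphism {mpoly K[N]} -> B}) (I : hilb K N n).
Hypothesis phi_surj : forall y, exists p, phi p = y.
Hypothesis phi_ker : forall p, I p <-> phi p = 0.

Lemma basis_modP m (b : 'I_m -> {mpoly K[N]}) :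
  basis_mod I b <-> basis_of fullv [tuple phi (b i) | i < m].
Proof.
set X := [tuple _ | i < m].
have XE (i : 'I_m) : X`_i = phi (b i) by rewrite -tnth_nth tnth_mktuple.
have sumE (p : {mpoly K[N]}) (r : 'rV[K]_m) :
    I (p - \sum_i r 0 i *: b i) <-> phi p = \sum_i r 0 i *: X`_i.
  have -> : \sum_i r 0 i *: X`_i = phi (\sum_i r 0 i *: b i).
    by rewrite linear_sum; apply: eq_bigr => i _; rewrite linearZ XE.
  rewrite phi_ker linearB /=; split=> [/eqP|->]; last by rewrite subrr.
  by rewrite subr_eq0 => /eqP.
split=> [Hb|/andP[/eqP spanX freeX] p].
  apply/andP; split.
    rewrite eqEsubv subvf /=; apply/subvP => y _.
    have [p <-] := phi_surj y; have [r [/sumE -> _]] := Hb p.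
    by apply: rpred_sum => i _; apply/memvZ/memv_span; rewrite mem_nth ?size_tuple.
  apply/freeP => k k0 i.
  have [r [_ runiq]] := Hb 0.
  have := runiq (\row_i k i); rewrite (runiq 0); last first.
    by apply/sumE; rewrite linear0 big1 // => j _; rewrite mxE scale0r.
  move=> H; have /rowP/(_ i) : 0 = \row_i k i :> 'rV[K]_m; last by rewrite !mxE.
  apply: H; apply/sumE; rewrite linear0 -[LHS]k0.
  by apply: eq_bigr => j _; rewrite mxE.
have phip : phi p \in <<X>>%VS by rewrite spanX memvf.
exists (\row_i coord X i (phi p)); split.
  apply/sumE; rewrite {1}(coord_span phip); apply: eq_bigr => i _.
  by rewrite mxE.
move=> r /sumE E; apply/rowP => i; rewrite mxE E linear_sum (bigD1 i) //=.
rewrite linearZ /= coord_free // eqxx mulr1 big1 ?addr0 // => j ji.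
by rewrite linearZ /= coord_free // (negPf ji) mulr0.
Qed.

Lemma hilb_dim : \dim (fullv : {vspace B}) = n.
Proof.
have [b /basis_modP Hb] := hilb_colength I.
by rewrite -(vector.size_basis Hb).
Qed.

(** The monomials span, so one can always add a monomial to a free family of
    fewer than n monomials.  This puts I in one of the charts on which the
    topology of the Hilbert scheme is defined. *)
Lemma monomial_basis : exists b : 'I_n -> 'X_{1..N}, basis_mod I (fun i => 'X_[b i]).
Proof.
suff H k : (k <= n)%N -> exists s : k.-tuple 'X_{1..N}, free [seq phi 'X_[m] | m <- s].
  have [s sfree] := H n (leqnn n); exists (tnth s); apply/basis_modP.
  have E : [tuple phi 'X_[tnth s i] | i < n] = [seq phi 'X_[m] | m <- s] :> seq B.
    apply: (@eq_from_nth _ 0); rewrite size_tuple ?size_map ?size_tuple // => i il.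
    rewrite (nth_map 0%MM) ?size_tuple // -[i]/(val (Ordinal il)) -!tnth_nth.
    by rewrite tnth_mktuple.
  by rewrite basisEfree subvf hilb_dim size_tuple leqnn E sfree.
elim: k => [|k IH] kn; first by exists [tuple]; rewrite nil_free.
have [s sfree] := IH (ltnW kn).
set X := [seq _ | _ <- _] in sfree.
have : ~~ (fullv <= <<X>>)%VS.
  apply: contraL kn => /dimvS; rewrite hilb_dim -leqNgt => /leq_trans; apply.
  by apply: leq_trans (dim_span _) _; rewrite size_map size_tuple.
case/subvPn => y _; have [p <-] := phi_surj y.
rewrite [p]mpolyE linear_sum => nX.
have /hasP[m _ mX] : has (fun m => phi 'X_[m] \notin <<X>>%VS) (msupp p).
  apply: contraR nX => /hasPn H; rewrite big_seq; apply: rpred_sum => m mp.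
  by rewrite linearZ memvZ //; apply/negPn/H.
by exists [tuple of m :: s]; rewrite /= free_cons mX.
Qed.

End Presentation.

(** * The equation of sums of cubes *)

Definition cubic_monomials c : seq 'X_{1..c} :=
  [seq s2m t | t : 3.-tuple 'I_c <- enum (basis c 3)].

Lemma cubic_monomialP c (m : 'X_{1..c}) : m \in cubic_monomials c ->
  exists i j k, m = (U_(i) + U_(j) + U_(k))%MM.
Proof.
case/mapP => t _ ->; exists (tnth t 0), (tnth t 1), (tnth t (inord 2)).
apply/mnmP => l; rewrite !mnmE.
case: t => [[|x [|y [|z [|]]]] //= ?].
by rewrite /tnth /= inordK //= addn0 addnA.
Qed.

Lemma mem_cubic c (i j k : 'I_c) : (U_(i) + U_(j) + U_(k))%MM \in cubic_monomials c.
Proof. by rewrite -basis_cover !mdegD !mdeg1. Qed.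

(** The values at the monomials are the coefficients, in divided powers, of
    the cubic form sum_q s_q l_q^3, where the linear form l_q has coefficients
    a q: the equation P vanishes on the variety of n-secants of the Veronese
    variety of cubes. *)
Definition secant_poly (K : fieldType) c n
    (P : {mpoly K[size (cubic_monomials c)]}) : Prop :=
  forall (s : 'I_n -> K) (a : 'I_n -> 'I_c -> K),
    P.@[fun t => \sum_q s q *
      ('X_[tnth (in_tuple (cubic_monomials c)) t]).@[a q]] = 0.

(** A sum of n weighted cubes has n (c + 1) parameters; when there are more
    coefficients than that, they are algebraically dependent. *)
Lemma secant_equation (K : fieldType) c n :
  (n * c.+1 < size (cubic_monomials c))%N ->
  exists2 P : {mpoly K[size (cubic_monomials c)]}, P != 0 & secant_poly n P.
Proof.
set r := size _ => nr.
pose T := ('I_n * option 'I_c)%type.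
pose V (x : T) : {mpoly K[#|{: T}|]} := 'X_(enum_rank x).
pose f (t : 'I_r) : {mpoly K[#|{: T}|]} :=
  \sum_q V (q, None) *
    \prod_i V (q, Some i) ^+ tnth (in_tuple (cubic_monomials c)) t i.
have [|P P0 Psec] := @algebraic_dependence K _ r f.
  by rewrite card_prod card_option !card_ord.
exists P => // s a; rewrite -[RHS](Psec (fun x =>
  let: (q, i) := (enum_val x : T) in if i is Some i then a q i else s q)).
apply: meval_eq => t; rewrite rmorph_sum; apply: eq_bigr => q _.
rewrite rmorphM rmorph_prod /= mevalXU enum_rankK mevalX; congr (_ * _).
by apply: eq_bigr => i _; rewrite rmorphXn /= mevalXU enum_rankK.
Qed.

(** * The fat point of the affine line is a limit of reduced points *)

Lemma distinct_points (K : closedFieldType) d : exists s : d.-tuple K, uniq s.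
Proof.
elim: d => [|d [s us]]; first by exists [tuple].
have [|z] := @poly_nonroot K (\prod_(x <- s) ('X - x%:P)).
  by rewrite monic_neq0 // monic_prod_XsubC.
by rewrite -/(root _ z) root_prod_XsubC => zs; exists [tuple of z :: s]; rewrite /= zs.
Qed.

Section FatPoint.
Variables (K : closedFieldType) (d : nat).
Local Notation S := {mpoly K[1]}.

Definition ucoef (p : S) i : K := p@_(U_(ord0) *+ i)%MM.

Lemma mnm1P (m : 'X_{1..1}) : m = (U_(ord0) *+ m ord0)%MM.
Proof.
by apply/mnmP => i; rewrite mulmnE mnm1E ord1 eqxx mul1n.
Qed.

Lemma ucoefX (m : 'X_{1..1}) i : ucoef 'X_[m] i = (m ord0 == i)%:R.
Proof.
rewrite /ucoef mcoeffX [in LHS](mnm1P m); congr (_ %:R); congr (nat_of_bool _).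
apply/eqP/eqP => [/mnmP/(_ ord0)|-> //].
by rewrite !mulmnE mnm1E eqxx !mul1n.
Qed.

Lemma ucoef_sum (I : finType) (F : I -> S) i : ucoef (\sum_l F l) i = \sum_l ucoef (F l) i.
Proof. exact: raddf_sum. Qed.

Lemma ucoefZ s p i : ucoef (s *: p) i = s * ucoef p i.
Proof. exact: mcoeffZ. Qed.

Lemma ucoefB p q i : ucoef (p - q) i = ucoef p i - ucoef q i.
Proof. exact: mcoeffB. Qed.

Lemma meval1X (m : 'X_{1..1}) x : ('X_[m]).@[fun=> x] = x ^+ m ord0 :> K.
Proof. by rewrite mevalX big_ord1. Qed.

Variable I : hilb K 1 d.
Hypothesis I_ucoef : forall p, I p <-> forall i, (i < d)%N -> ucoef p i = 0.

Section Chart.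
Variable b : 'I_d -> 'X_{1..1}.
Hypothesis Hb : basis_mod I (fun i => 'X_[b i]).
Local Notation e i := (b i ord0).

Lemma chart_lt i : (e i < d)%N.
Proof.
rewrite ltnNge; apply/negP => di.
have H : coords I (fun i => 'X_[b i]) 'X_[b i] 0.
  apply/coords0/I_ucoef => l ld; rewrite ucoefX; case: eqP => // E.
  by move: ld; rewrite -E ltnNge di.
have := coords_uniq Hb H (coords_basis I (fun i => 'X_[b i]) i).
by move/rowP/(_ i); rewrite !mxE !eqxx => /eqP; rewrite eq_sym oner_eq0.
Qed.

Lemma chart_inj i j : e i = e j -> i = j.
Proof.
move=> E; have Eb : b i = b j by rewrite (mnm1P (b i)) E -mnm1P.
have := coords_basis I (fun i => 'X_[b i]) i; rewrite /= Eb => H.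
have := coords_uniq Hb H (coords_basis I (fun i => 'X_[b i]) j).
move/rowP/(_ j); rewrite !mxE !eqxx /=.
by case: eqP => // _ /eqP; rewrite eq_sym oner_eq0.
Qed.

(** The b i are a permutation of the monomials of degree below d, so this is a
    Vandermonde matrix up to the order of its rows. *)
Definition vander (a : 'I_d -> K) : 'M[K]_d := \matrix_(i, q) a q ^+ e i.

Lemma vander_unit a : injective a -> vander a \in unitmx.
Proof.
move=> a_inj; rewrite -row_free_unit; apply/row_freeP.
suff: kermx (vander a) == 0 by rewrite kermx_eq0 => /row_freeP.
apply/eqP/row_matrixP => l; rewrite row0; set v := row l _.
have vV : v *m vander a = 0 by rewrite -row_mul mulmx_ker row0.
pose p : {poly K} := \sum_i v 0 i *: 'X^(e i).
have p0 : p = 0.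
  apply: (@roots_geq_poly_eq0 _ _ [seq a q | q <- enum 'I_d]).
  - apply/allP => _ /mapP[q _ ->]; apply/eqP.
    have /rowP/(_ q) := vV; rewrite !mxE => <-; rewrite horner_sum.
    by apply: eq_bigr => i _; rewrite hornerZ hornerXn !mxE.
  - by rewrite map_inj_uniq ?enum_uniq.
  - rewrite size_map size_enum_ord; apply: (leq_trans (size_sum _ _ _)).
    apply/bigmax_leqP => i _; apply: (leq_trans (size_scale_leq _ _)).
    by rewrite size_polyXn chart_lt.
apply/rowP => i; rewrite [RHS]mxE; have := congr1 (fun p : {poly K} => p`_(e i)) p0.
rewrite coef0 coef_sum (bigD1 i) //= coefZ coefXn eqxx mulr1 big1 ?addr0 // => j ji.
rewrite coefZ coefXn; case: eqP => [/chart_inj E|_]; last by rewrite mulr0.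
by rewrite E eqxx in ji.
Qed.

Section Points.
Variable a : 'I_d -> K.
Hypothesis a_inj : injective a.

Definition points_ideal (p : S) : Prop := forall q, p.@[fun=> a q] = 0.

Lemma points_coordsP p (r : 'rV[K]_d) :
  points_ideal (p - \sum_i r 0 i *: 'X_[b i]) <->
  r *m vander a = \row_q p.@[fun=> a q].
Proof.
have E q : (p - \sum_i r 0 i *: 'X_[b i]).@[fun=> a q] =
    p.@[fun=> a q] - (r *m vander a) 0 q.
  rewrite mevalB; congr (_ - _); rewrite raddf_sum mxE; apply: eq_bigr => i _ /=.
  by rewrite mevalZ meval1X mxE.
split=> [H|H q]; last by rewrite E H mxE subrr.
by apply/rowP => q; rewrite [RHS]mxE; apply/eqP; rewrite eq_sym -subr_eq0 -E H.
Qed.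

Lemma points_basis : basis_mod points_ideal (fun i => 'X_[b i]).
Proof.
move=> p; have Vu := vander_unit a_inj.
exists ((\row_q p.@[fun=> a q]) *m invmx (vander a)); split.
  by apply/points_coordsP; rewrite mulmxKV.
by move=> r /points_coordsP <-; rewrite mulmxK.
Qed.

Lemma points_ideal_pred : ideal_pred points_ideal.
Proof.
split=> [q|p p' Hp Hp' q|p p' Hp q]; first exact: meval0.
  by rewrite mevalD Hp Hp' addr0.
by rewrite mevalM Hp mulr0.
Qed.

Definition points : hilb K 1 d := Hilb points_ideal_pred (ex_intro _ _ points_basis).

Lemma points_reduced : reduced points.
Proof.
move=> p n H q; have := H q; rewrite rmorphXn /= => /eqP.
by rewrite expf_eq0 => /andP[_ /eqP].
Qed.

End Points.
End Chart.

(** Let a_1, ..., a_d be distinct.  In a chart around I, whose monomials are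
    necessarily those of degree below d, the ideal of the points t a_q has the
    coordinates t ^ (k - e) * C_(k, e), where C_(k, e) are the coordinates at
    t = 1 and k, e are the exponents of the monomial to be reduced and of the
    basis monomial.  They are polynomials in t whose values at 0 are the
    coordinates of I, so an open condition valid at I is valid for all but
    finitely many t. *)
Lemma fat_point_closure : zariski_closure (@reduced K 1 d) I.
Proof.
move=> U openU UI; have [b [r [w [f [[Hb [c [Ic fc]]] sub]]]]] := openU I UI.
have [s us] := distinct_points K d; pose a := tnth s.
have a_inj : injective a by apply/tuple_uniqP.
pose e i := b i ord0; pose k l := w l ord0.
have c0 l i : (d <= k l)%N -> c l i = 0.
  move=> dk; have H : coords I (fun i => 'X_[b i]) 'X_[w l] 0.
    apply/coords0/I_ucoef => j jd; rewrite ucoefX; case: eqP => // E.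
    by move: jd; rewrite -E ltnNge dk.
  have H' : coords I (fun i => 'X_[b i]) 'X_[w l] (row l c).
    by rewrite /coords; under eq_bigr do rewrite mxE.
  by have /rowP/(_ i) := coords_uniq Hb H' H; rewrite !mxE.
have Xw l : (k l < d)%N -> 'X_[w l] = \sum_i c l i *: 'X_[b i].
  move=> kd; apply/eqP; rewrite -subr_eq0; apply/eqP/mpolyP => m.
  rewrite (mnm1P m) mcoeff0 -/(ucoef _ _); have [md|dm] := ltnP (m ord0) d.
    by have /I_ucoef := Ic l; apply.
  rewrite ucoefB ucoef_sum ucoefX (ltn_eqF (leq_trans kd dm)) big1 ?subr0 // => i _.
  by rewrite ucoefZ ucoefX (ltn_eqF (leq_trans (chart_lt Hb i) dm)) mulr0.
pose C1 := (\matrix_(l, q) a q ^+ k l) *m invmx (vander b a).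
have C1P l q : a q ^+ k l = \sum_i C1 l i * a q ^+ e i.
  have : C1 *m vander b a = \matrix_(l, q) a q ^+ k l.
    by rewrite mulmxKV // (vander_unit Hb).
  move/matrixP/(_ l q); rewrite !mxE => <-; apply: eq_bigr => i _.
  by rewrite !mxE.
(* The truncated difference k l - e i would be wrong for k l < e i; but for
   k l < d the coordinates do not depend on t at all. *)
pose G : 'M[{poly K}]_(r, d) := \matrix_(l, i)
  if (k l < d)%N then (c l i)%:P else C1 l i *: 'X^(k l - e i).
pose F := mmap polyC (fun x => mxvec G 0 x) f.
have FE t : F.[t] = f.@[mxvec (map_mx (horner^~ t) G) 0].
  rewrite mevalE /F /mmap horner_sum; apply: eq_bigr => m _.
  rewrite hornerM hornerC /mmap1 horner_prod; congr (_ * _).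
  by apply: eq_bigr => x _; rewrite horner_exp -map_mxvec mxE.
have F0 : F != 0.
  apply: contra fc => /eqP F0; have := FE 0; rewrite F0 horner0.
  rewrite (_ : map_mx _ G = c) => [<- //|]; apply/matrixP => l i; rewrite !mxE.
  case: ltnP => kd; first by rewrite hornerC.
  rewrite c0 // hornerZ hornerXn expr0n subn_eq0 leqNgt.
  by rewrite (leq_trans (chart_lt Hb i) kd) mulr0.
(* The factor 'X excludes t = 0. *)
have [t] := poly_nonroot (mulf_neq0 F0 (monic_neq0 (monicX K))).
rewrite hornerM hornerX mulf_eq0 negb_or FE => /andP[ft t0].
pose at_ q := t * a q.
have at_inj : injective at_ by move=> q q' /(mulfI t0)/a_inj.
exists (points Hb at_inj); split; last exact: points_reduced.
apply: sub; split; first exact: points_basis.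
exists (map_mx (horner^~ t) G); split=> // l q.
apply/eqP; rewrite mevalB meval1X subr_eq0 raddf_sum /=; apply/eqP.
have [kd|dk] := ltnP (k l) d.
  rewrite -(meval1X (w l)) Xw // raddf_sum; apply: eq_bigr => i _ /=.
  by rewrite !mevalZ !mxE kd hornerC.
rewrite /at_ exprMn -/(k l) C1P mulr_sumr; apply: eq_bigr => i _.
rewrite mevalZ meval1X !mxE ltnNge dk /= hornerZ hornerXn exprMn -/(e i).
rewrite mulrCA -!mulrA; congr (_ * _); rewrite mulrA -exprD subnK //.
exact: leq_trans (ltnW (chart_lt Hb i)) dk.
Qed.

End FatPoint.

(** * The apolar algebra of a cubic plus the fourth power of a new variable *)

(** The three components are the coordinates along 1, x, ..., x^4, along the
    y_i, and along the dual elements Y_i.  The function g gives the coefficients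
    of the cubic in divided powers; it occurs in the type only because the
    product depends on it. *)
Definition apolar (K : fieldType) c (g : 'X_{1..c} -> K) : Type :=
  ('rV[K]_5 * 'rV[K]_c * 'rV[K]_c)%type.

Section Apolar.
Variables (K : fieldType) (c : nat) (g : 'X_{1..c} -> K).
Implicit Types (u v w : 'rV[K]_c) (p q r : 'rV[K]_5).

(** Indexing the coefficients by monomials makes this tensor symmetric. *)
Definition gtensor i j k := g (U_(i) + U_(j) + U_(k))%MM.

Definition dot u v : K := \sum_i u 0 i * v 0 i.

Definition contract u v : 'rV[K]_c :=
  \row_k \sum_i \sum_j gtensor i j k * (u 0 i * v 0 j).

(** [poly_rV] truncates: this is the product of K[x]/x^5. *)
Definition tmul p q : 'rV[K]_5 := poly_rV (rVpoly p * rVpoly q).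

Definition socle : 'rV[K]_5 := delta_mx 0 ord_max.

Lemma dotC u v : dot u v = dot v u.
Proof. by apply: eq_bigr => i _; rewrite mulrC. Qed.

Lemma dotDl u v w : dot (u + v) w = dot u w + dot v w.
Proof. by rewrite -big_split; apply: eq_bigr => i _; rewrite mxE mulrDl. Qed.

Lemma dotZl a u v : dot (a *: u) v = a * dot u v.
Proof. by rewrite mulr_sumr; apply: eq_bigr => i _; rewrite mxE mulrA. Qed.

Lemma contractC u v : contract u v = contract v u.
Proof.
apply/rowP => k; rewrite !mxE exchange_big; apply: eq_bigr => i _.
by apply: eq_bigr => j _; rewrite [u 0 _ * _]mulrC /gtensor [(U_(i) + _)%MM]addmC.
Qed.

Lemma contractDl u v w : contract (u + v) w = contract u w + contract v w.
Proof.
apply/rowP => k; rewrite !mxE -big_split; apply: eq_bigr => i _.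
by rewrite -big_split; apply: eq_bigr => j _; rewrite mxE mulrDl mulrDr.
Qed.

Lemma contractZl a u v : contract (a *: u) v = a *: contract u v.
Proof.
apply/rowP => k; rewrite !mxE mulr_sumr; apply: eq_bigr => i _.
by rewrite mulr_sumr; apply: eq_bigr => j _; rewrite mxE; ring.
Qed.

Lemma dot0 u : dot 0 u = 0.
Proof. by rewrite -(scale0r (0 : 'rV[K]_c)) dotZl mul0r. Qed.

Lemma contract0 u : contract 0 u = 0.
Proof. by rewrite -(scale0r (0 : 'rV[K]_c)) contractZl !scale0r. Qed.

Lemma dot_contractE u v w : dot (contract u v) w =
  \sum_i \sum_j \sum_k gtensor i j k * (u 0 i * v 0 j * w 0 k).
Proof.
rewrite /dot (eq_bigr (fun k => \sum_i \sum_j gtensor i j k * (u 0 i * v 0 j * w 0 k))).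
  rewrite exchange_big; apply: eq_bigr => i _; exact: exchange_big.
move=> k _; rewrite mxE mulr_suml; apply: eq_bigr => i _.
by rewrite mulr_suml; apply: eq_bigr => j _; ring.
Qed.

Lemma dot_contract u v w : dot (contract u v) w = dot u (contract v w).
Proof.
rewrite [RHS]dotC !dot_contractE exchange_big; apply: eq_bigr => j _.
rewrite exchange_big; apply: eq_bigr => k _; apply: eq_bigr => i _.
rewrite /gtensor -[(U_(i) + _ + _)%MM]addmA addmC; ring.
Qed.

Lemma tmulE p q (i : 'I_5) :
  tmul p q 0 i = \sum_(l < i.+1) (rVpoly p)`_l * (rVpoly q)`_(i - l).
Proof. by rewrite mxE coefM. Qed.

Lemma tmul0 p q : tmul p q 0 0 = p 0 0 * q 0 0.
Proof. by rewrite tmulE big_ord1 !(coef_rVpoly_ord _ (0 : 'I_5)). Qed.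

Lemma tmulC p q : tmul p q = tmul q p.
Proof. by rewrite /tmul mulrC. Qed.

Lemma tmul_poly_rV (P Q : {poly K}) :
  tmul (poly_rV P) (poly_rV Q) = poly_rV (P * Q).
Proof.
apply/rowP => i; rewrite tmulE mxE coefM; apply: eq_bigr => l _.
have li : (l < 5)%N by apply: leq_trans (ltn_ord l) (ltn_ord i).
have di : (i - l < 5)%N by apply: leq_ltn_trans (leq_subr _ _) (ltn_ord i).
by rewrite (coef_rVpoly_ord _ (Ordinal li)) (coef_rVpoly_ord _ (Ordinal di)) !mxE.
Qed.

Lemma tmulA p q r : tmul p (tmul q r) = tmul (tmul p q) r.
Proof.
rewrite -[p]rVpolyK -[q]rVpolyK -[r]rVpolyK.
by rewrite !tmul_poly_rV mulrA.
Qed.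

Lemma tmulDl p q r : tmul (p + q) r = tmul p r + tmul q r.
Proof. by rewrite /tmul linearD mulrDl linearD. Qed.

Lemma tmulZl a p q : tmul (a *: p) q = a *: tmul p q.
Proof. by rewrite /tmul linearZ -scalerAl linearZ. Qed.

Lemma tmul_socle p : tmul p socle = p 0 0 *: socle.
Proof.
have -> : socle = poly_rV 'X^4.
  by apply/rowP => i; rewrite !mxE coefXn.
rewrite -{1}[p]rVpolyK tmul_poly_rV; apply/rowP => i; rewrite !mxE coefMXn coefXn.
case: ltngtP => [i4|i4|->].
- by rewrite mulr0.
- by have := ltn_ord i; rewrite ltnS leqNgt i4.
- by rewrite subnn mulr1 (coef_rVpoly_ord _ (0 : 'I_5)).
Qed.

Local Notation A := (apolar g).
HB.instance Definition _ := Vector.on A.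

Definition xpart (a : A) : 'rV[K]_5 := a.1.1.
Definition ypart (a : A) : 'rV[K]_c := a.1.2.
Definition Ypart (a : A) : 'rV[K]_c := a.2.

(** The residue map onto K. *)
Definition aug (a : A) : K := xpart a 0 0.

Definition apolar_mul (a b : A) : A :=
  (tmul (xpart a) (xpart b)
     + (dot (ypart a) (Ypart b) + dot (ypart b) (Ypart a)) *: socle,
   aug a *: ypart b + aug b *: ypart a,
   aug a *: Ypart b + aug b *: Ypart a + contract (ypart a) (ypart b)).

Definition apolar_one : A := (poly_rV 1, 0, 0).

Lemma apolar_eq (a b : A) :
  xpart a = xpart b -> ypart a = ypart b -> Ypart a = Ypart b -> a = b.
Proof.
by case: a b => [[? ?] ?] [[? ?] ?]; rewrite /xpart /ypart /Ypart /= => -> -> ->.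
Qed.

Lemma xpartD (a b : A) : xpart (a + b) = xpart a + xpart b.
Proof. by []. Qed.
Lemma ypartD (a b : A) : ypart (a + b) = ypart a + ypart b.
Proof. by []. Qed.
Lemma YpartD (a b : A) : Ypart (a + b) = Ypart a + Ypart b.
Proof. by []. Qed.
Lemma augD (a b : A) : aug (a + b) = aug a + aug b.
Proof. by rewrite /aug xpartD mxE. Qed.
Lemma xpartZ s (a : A) : xpart (s *: a) = s *: xpart a.
Proof. by []. Qed.
Lemma ypartZ s (a : A) : ypart (s *: a) = s *: ypart a.
Proof. by []. Qed.
Lemma YpartZ s (a : A) : Ypart (s *: a) = s *: Ypart a.
Proof. by []. Qed.
Lemma augZ s (a : A) : aug (s *: a) = s * aug a.
Proof. by rewrite /aug xpartZ mxE. Qed.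

Lemma xpart_mul (a b : A) : xpart (apolar_mul a b) = tmul (xpart a) (xpart b)
     + (dot (ypart a) (Ypart b) + dot (ypart b) (Ypart a)) *: socle.
Proof. by []. Qed.
Lemma ypart_mul a b : ypart (apolar_mul a b) = aug a *: ypart b + aug b *: ypart a.
Proof. by []. Qed.
Lemma Ypart_mul a b : Ypart (apolar_mul a b) =
   aug a *: Ypart b + aug b *: Ypart a + contract (ypart a) (ypart b).
Proof. by []. Qed.

Lemma socle0 : socle 0 0 = 0. Proof. by rewrite mxE. Qed.

Lemma aug_mul a b : aug (apolar_mul a b) = aug a * aug b.
Proof. by rewrite /aug mxE tmul0 [X in _ + X]mxE socle0 mulr0 addr0. Qed.

Lemma apolar_mulC : commutative apolar_mul.
Proof.
move=> a b; rewrite /apolar_mul tmulC (contractC (ypart a)).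
by rewrite [dot (ypart a) _ + _]addrC [aug a *: ypart b + _]addrC
  [aug a *: Ypart b + _]addrC.
Qed.

Lemma apolar_mulDl : left_distributive apolar_mul +%R.
Proof.
move=> a b d; apply: apolar_eq;
  rewrite !(xpartD, ypartD, YpartD, xpart_mul, ypart_mul, Ypart_mul) ?augD.
- rewrite tmulDl [dot _ (_ + _)]dotC !dotDl ![dot _ (ypart d)]dotC [RHS]addrACA -scalerDl.
  by congr (_ + _ *: _); ring.
- by rewrite scalerDl scalerDr addrACA.
- by rewrite scalerDl scalerDr contractDl [RHS]addrACA; congr (_ + _); rewrite addrACA.
Qed.

(** The only nontrivial point is that (u v) w = u (v w) for u, v, w in the span
    of the y_i, which is [dot_contract], the symmetry of the cubic. *)
Lemma apolar_mulA : associative apolar_mul.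
Proof.
move=> a b d; apply: apolar_eq;
  rewrite !(xpart_mul, ypart_mul, Ypart_mul, aug_mul).
- rewrite ![tmul _ (_ + _)]tmulC !tmulDl !tmulZl.
  rewrite ![tmul _ (xpart a)]tmulC [tmul socle _]tmulC !tmul_socle.
  rewrite tmulA -!addrA; congr (_ + _); rewrite !scalerA -!scalerDl; congr (_ *: _).
  rewrite -/(aug a) -/(aug d).
  rewrite ![dot _ (_ + _)]dotC !dotDl !dotZl.
  rewrite [dot (contract _ _) (ypart a)]dotC -dot_contract.
  by rewrite ![dot (Ypart _) _]dotC; ring.
- by rewrite !scalerDr !scalerA addrA ![aug d * _]mulrC.
- rewrite ![contract _ (_ + _)]contractC !contractDl !contractZl.
  rewrite !scalerDr !scalerA.
  rewrite ![aug d * _]mulrC [contract (ypart d) _]contractC.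
  rewrite [contract (ypart b) (ypart a)]contractC -!addrA; congr (_ + _).
  by congr (_ + _); rewrite addrCA; congr (_ + _); rewrite addrA addrC.
Qed.

Lemma apolar_mul1 : left_id apolar_one apolar_mul.
Proof.
have aug1 : aug apolar_one = 1 by rewrite /aug mxE coef1.
have [y1 Y1] : ypart apolar_one = 0 /\ Ypart apolar_one = 0 by [].
move=> a; apply: apolar_eq; rewrite ?(xpart_mul, ypart_mul, Ypart_mul) ?aug1 ?scale1r.
- rewrite y1 Y1 [dot (ypart a) _]dotC !dot0 addr0 scale0r addr0.
  by rewrite -[xpart a]rVpolyK tmul_poly_rV mul1r.
- by rewrite y1 scaler0 addr0.
- by rewrite y1 Y1 scaler0 contract0 !addr0.
Qed.

Lemma apolar_one_neq0 : apolar_one != 0.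
Proof.
apply/eqP => /(congr1 aug); rewrite /aug !mxE coef1 => /eqP.
by rewrite oner_eq0.
Qed.

HB.instance Definition _ := GRing.Zmodule_isComNzRing.Build A
  apolar_mulA apolar_mulC apolar_mul1 apolar_mulDl apolar_one_neq0.

Lemma apolar_scaleAl (s : K) (a b : A) : s *: (a * b) = (s *: a) * b.
Proof.
apply: apolar_eq; rewrite ?(xpartZ, ypartZ, YpartZ);
  rewrite !(xpart_mul, ypart_mul, Ypart_mul) ?(xpartZ, ypartZ, YpartZ, augZ).
- rewrite tmulZl dotZl [dot (ypart b) (_ *: _)]dotC dotZl [dot (Ypart a) _]dotC.
  by rewrite -mulrDr -scalerA -scalerDr.
- by rewrite scalerDr !scalerA ![_ * aug b]mulrC.
- by rewrite contractZl !scalerDr !scalerA ![_ * aug b]mulrC.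
Qed.

HB.instance Definition _ := GRing.Lmodule_isLalgebra.Build K A apolar_scaleAl.
HB.instance Definition _ := GRing.Lalgebra_isComAlgebra.Build K A.
HB.instance Definition _ := Algebra_isFalgebra.Build K A.

Lemma mulE (a b : A) : a * b = apolar_mul a b. Proof. by []. Qed.
Lemma aug1 : aug (1 : A) = 1. Proof. by rewrite /aug mxE coef1. Qed.

(** The i-th power of the maximal ideal, when the y_i y_j span the Y_k: x has
    order 1, and so do the y_i, while the Y_i have order 2. *)
Definition filt i (a : A) : Prop :=
  [/\ forall l : 'I_5, (l < i)%N -> xpart a 0 l = 0,
      (1 < i)%N -> ypart a = 0 & (2 < i)%N -> Ypart a = 0].

Lemma filtM i j a b : filt i a -> filt j b -> filt (i + j) (a * b).
Proof.
move=> [xa ya Ya] [xb yb Yb]; rewrite mulE /filt xpart_mul ypart_mul Ypart_mul.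
have xa0 : (0 < i)%N -> aug a = 0 by move=> i0; apply: xa.
have xb0 : (0 < j)%N -> aug b = 0 by move=> j0; apply: xb.
split.
- move=> l lij; rewrite mxE tmulE big1 => [|s _].
    rewrite add0r mxE mxE eqxx /=; case: eqP => [El|_]; last by rewrite mulr0.
    rewrite mulr1; have {El}E : (4 < i + j)%N by move: lij; rewrite El.
    have -> : dot (ypart a) (Ypart b) = 0.
      have [/ya->|i1] := ltnP 1 i; first by rewrite dot0.
      rewrite Yb 1?dotC ?dot0 // -(ltn_add2l 1); apply: leq_trans (leq_add i1 (leqnn j)); exact: ltnW.
    have -> : dot (ypart b) (Ypart a) = 0; last by rewrite addr0.
    have [/yb->|j1] := ltnP 1 j; first by rewrite dot0.
    rewrite Ya 1?dotC ?dot0 // -(ltn_add2r 1); apply: leq_trans (leq_add (leqnn i) j1); exact: ltnW.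
  have s5 : (s < 5)%N by apply: leq_trans (ltn_ord s) (ltn_ord l).
  have d5 : (l - s < 5)%N by apply: leq_ltn_trans (leq_subr _ _) (ltn_ord l).
  rewrite (coef_rVpoly_ord _ (Ordinal s5)) (coef_rVpoly_ord _ (Ordinal d5)).
  have [si|si] := ltnP s i; first by rewrite xa ?mul0r.
  rewrite xb ?mulr0 //= ltn_subLR -1?ltnS //; apply: leq_trans lij _; exact: leq_add.
- move=> ij; have -> : aug a *: ypart b = 0.
    case: (posnP i) ij => [-> ij|/xa0-> _]; last by rewrite scale0r.
    by rewrite yb ?scaler0.
  case: (posnP j) ij => [-> ij|/xb0-> _]; last by rewrite scale0r addr0.
  by rewrite ya ?scaler0 ?addr0 // -(addn0 i).
- move=> ij; have -> : contract (ypart a) (ypart b) = 0.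
    have [/ya->|i1] := ltnP 1 i; first exact: contract0.
    rewrite yb 1?contractC ?contract0 // -(ltn_add2l 1).
    exact: leq_trans ij (leq_add i1 (leqnn j)).
  have -> : aug a *: Ypart b = 0.
    case: (posnP i) ij => [-> ij|/xa0-> _]; last by rewrite scale0r.
    by rewrite Yb ?scaler0.
  case: (posnP j) ij => [-> ij|/xb0-> _]; last by rewrite scale0r !addr0.
  by rewrite Ya ?scaler0 ?addr0 // -(addn0 i).
Qed.

Lemma filt5 a : filt 5 a -> a = 0.
Proof.
move=> [xa ya Ya]; apply: apolar_eq; rewrite ?ya ?Ya //.
by apply/rowP => l; rewrite xa ?mxE.
Qed.

Lemma filtX i a n : filt i a -> filt (n * i) (a ^+ n).
Proof.
move=> Ha; elim: n => [|n IH]; first by rewrite expr0; split.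
by rewrite exprS mulSn; apply: filtM.
Qed.

Lemma filt1 a : filt 1 a <-> aug a = 0.
Proof.
split=> [[xa _ _]|a0]; first exact: xa.
by split=> // l; rewrite ltnS leqn0 => /eqP l0; rewrite -[RHS]a0; congr (xpart a 0 _); apply: val_inj.
Qed.

Definition aug_fun (a : A) : K^o := aug a.
Lemma aug_is_linear : linear aug_fun.
Proof. by move=> s a b; rewrite /aug_fun augD augZ. Qed.
HB.instance Definition _ := GRing.isLinear.Build K A K^o _ aug_fun aug_is_linear.

Definition apolar_max : {vspace A} := lker (linfun aug_fun).

Lemma mem_apolar_max a : (a \in apolar_max) = (aug a == 0).
Proof. by rewrite memv_ker lfunE. Qed.

Lemma augM (a b : A) : aug (a * b) = aug a * aug b. Proof. exact: aug_mul. Qed.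

(** If aug a = s is not zero, then u = s - a is nilpotent, and a divides
    s ^ 5 - u ^ 5 = s ^ 5, hence is a unit. *)
Lemma proper_sub_max (J : {vspace A}) :
  is_ideal J -> J != fullv -> (J <= apolar_max)%VS.
Proof.
move=> HJ nJ; apply/subvP => a aJ; rewrite mem_apolar_max.
apply: contraR nJ => s0; set s := aug a in s0.
pose u : A := s%:A - a.
have u5 : u ^+ 5 = 0.
  apply: filt5; apply: (@filtX 1%N _ 5); apply/filt1.
  by rewrite augD augZ aug1 mulr1 -scaleN1r augZ mulN1r subrr.
have J1 : (s ^+ 5)%:A \in J.
  have := subrXX (s%:A : A) u 5; rewrite u5 subr0 opprB addrC subrK.
  by rewrite exprZn expr1n mulrC => ->; apply: ideal_memM.
rewrite eqEsubv subvf; apply/subvP => b _.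
rewrite -[b]mulr1; apply: ideal_memM => //.
rewrite -[1]scale1r -(mulVf (expf_neq0 5 s0)) -scalerA.
exact: memvZ.
Qed.

Lemma apolar_max_maximal : maximal_ideal apolar_max.
Proof.
split.
- by apply: is_idealP => a x; rewrite !mem_apolar_max augM => /eqP->; rewrite mulr0.
- apply/eqP => E; have := memvf (1 : A); rewrite -E mem_apolar_max aug1.
  by rewrite oner_eq0.
- move=> J HJ sJ nJ; apply/eqP; rewrite eqEsubv sJ andbT.
  exact: proper_sub_max.
Qed.

Lemma apolar_max_unique (I : {vspace A}) : maximal_ideal I -> I = apolar_max.
Proof.
case=> HI nI maxI; have [Hm nm _] := apolar_max_maximal.
by rewrite (maxI apolar_max) // proper_sub_max.
Qed.

HB.instance Definition _ :=
  isLocal.Build K A apolar_max_maximal apolar_max_unique.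

End Apolar.

(** * Powers of the maximal ideal, socle and embedding dimension *)

Lemma dim_lker_onto (K : fieldType) (U V : vectType K) (f : {linear U -> V}) :
  (forall v, exists u, f u = v) ->
  (\dim (lker (linfun f)) + \dim (fullv : {vspace V}) = \dim (fullv : {vspace U}))%N.
Proof.
move=> fsurj; rewrite -(limg_ker_dim (linfun f) fullv) capfv; congr (_ + \dim _)%N.
apply/eqP; rewrite eqEsubv subvf andbT; apply/subvP => v _.
by have [u <-] := fsurj v; rewrite -[f u]lfunE memv_img ?memvf.
Qed.

Section Structure.
Variables (K : fieldType) (c : nat) (g : 'X_{1..c} -> K).
Local Notation A := (apolar g).
Implicit Types (a b : A).

Lemma dim_apolar : \dim (fullv : {vspace A}) = (5 + c + c)%N.
Proof.
rewrite dimvf (_ : dim A = dim 'rV[K]_5 + dim 'rV[K]_c + dim 'rV[K]_c)%N //.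
by rewrite !dim_matrix; lia.
Qed.

Definition xinj (p : 'rV[K]_5) : A := (p, 0, 0).
Definition xel : A := xinj (poly_rV 'X).
Definition yel (v : 'rV[K]_c) : A := (0, v, 0).
Definition Yel (w : 'rV[K]_c) : A := (0, 0, w).

Lemma xinj_linear : linear xinj.
Proof.
by move=> s p q; apply: apolar_eq; rewrite /xpart /ypart /Ypart /= ?scaler0 ?addr0.
Qed.
HB.instance Definition _ := GRing.isLinear.Build K 'rV[K]_5 A _ xinj xinj_linear.

Lemma Yel_linear : linear Yel.
Proof.
by move=> s p q; apply: apolar_eq; rewrite /xpart /ypart /Ypart /= ?scaler0 ?addr0.
Qed.
HB.instance Definition _ := GRing.isLinear.Build K 'rV[K]_c A _ Yel Yel_linear.

Lemma xelX n : xel ^+ n = xinj (poly_rV 'X^n).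
Proof.
elim: n => [|n IH]; first by rewrite !expr0.
rewrite exprS IH; apply: apolar_eq; rewrite mulE ?(xpart_mul, ypart_mul, Ypart_mul) /=.
- by rewrite !dot0 addr0 scale0r addr0 tmul_poly_rV -exprS.
- by rewrite !scaler0 addr0.
- by rewrite !scaler0 !addr0 contract0 addr0.
Qed.

Lemma xpart_mulX a n (l : 'I_5) (k : 'I_5) :
  (k + n = l)%N -> xpart (a * xel ^+ n) 0 l = xpart a 0 k.
Proof.
move=> E; rewrite xelX mulE xpart_mul /= [dot (ypart a) _]dotC !dot0 addr0 scale0r addr0.
rewrite -{1}[xpart a]rVpolyK tmul_poly_rV mxE coefMXn -E ltnNge leq_addl /=.
by rewrite addnK coef_rVpoly_ord.
Qed.

Lemma apolar_decomp a :
  a = \sum_(l < 5) xpart a 0 l *: xel ^+ l + (yel (ypart a) + Yel (Ypart a)).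
Proof.
have sumE : \sum_(l < 5) xpart a 0 l *: xel ^+ l = xinj (xpart a).
  rewrite {2}[xpart a]row_sum_delta linear_sum; apply: eq_bigr => l _.
  rewrite linearZ xelX /=; congr (_ *: xinj _); apply/rowP => k.
  by rewrite !mxE coefXn eqxx.
rewrite sumE; apply: apolar_eq; rewrite /xpart /ypart /Ypart /=.
- by rewrite !addr0.
- by rewrite addr0 add0r.
- by rewrite !add0r.
Qed.

(** Its kernel is the i-th step of the filtration, which presents that step as
    a subspace. *)
Definition trunc i a : A :=
  (\row_l (if (l < i)%N then xpart a 0 l else 0),
   if (1 < i)%N then ypart a else 0, if (2 < i)%N then Ypart a else 0).

Lemma trunc_linear i : linear (trunc i).
Proof.
move=> s a b; apply: apolar_eq; rewrite /trunc /= ?(xpartD, ypartD, YpartD, xpartZ, ypartZ, YpartZ).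
- apply/rowP => l; rewrite !mxE /=; case: ifP; by rewrite ?mulr0 ?addr0.
- by rewrite /ypart /=; case: ifP; rewrite // scaler0 addr0.
- by rewrite /Ypart /=; case: ifP; rewrite // scaler0 addr0.
Qed.
HB.instance Definition _ i := GRing.isLinear.Build K A A _ (trunc i) (trunc_linear i).

Definition filtv i : {vspace A} := lker (linfun (trunc i)).

Lemma mem_filtv i a : reflect (filt i a) (a \in filtv i).
Proof.
rewrite memv_ker lfunE /=; apply: (iffP eqP) => [E|[xa ya Ya]].
  split=> [l li|i1|i2].
  - by have /(congr1 (fun b : A => xpart b 0 l)) := E; rewrite /xpart /= !mxE li.
  - by have /(congr1 (fun b : A => ypart b)) := E; rewrite /ypart /= i1.
  - by have /(congr1 (fun b : A => Ypart b)) := E; rewrite /Ypart /= i2.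
apply: apolar_eq; rewrite /trunc /xpart /ypart /Ypart /=.
- by apply/rowP => l; rewrite !mxE; case: ifP => // /xa.
- by case: ifP => // /ya.
- by case: ifP => // /Ya.
Qed.

Lemma mem_maxideal a : (a \in \m_A) = (aug a == 0).
Proof. exact: mem_apolar_max. Qed.

Lemma ideal_exp_filt n a : a \in ideal_exp \m_A n -> filt n a.
Proof.
have sub1 : (\m_A <= filtv 1)%VS.
  by apply/subvP => b; rewrite mem_maxideal => /eqP/filt1/mem_filtv.
elim: n a => [|n IH] a aI; first by split.
suff: (ideal_exp \m_A n.+1 <= filtv n.+1)%VS by move/subvP/(_ a aI)/mem_filtv.
case: n IH {aI} => [|n] IH; first by rewrite /ideal_exp expv1.
rewrite /ideal_exp expvSl; apply/prodvP => u v /(subvP sub1)/mem_filtv Hu Hv.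
by apply/mem_filtv; apply: (filtM Hu (IH v Hv)).
Qed.

Lemma ideal_exp5 n a : (4 < n)%N -> a \in ideal_exp \m_A n -> a = 0.
Proof.
move=> n5 /ideal_exp_filt [xa ya Ya]; apply: filt5; split=> [l l5|_|_].
- by apply: xa; apply: leq_trans n5.
- by apply: ya; apply: leq_trans n5.
- by apply: Ya; apply: leq_trans n5.
Qed.

Let m_ideal : is_ideal \m_A := maxideal_ideal A.

Lemma xel_exp n : xel ^+ n \in ideal_exp \m_A n.
Proof.
elim: n => [|n IH]; first exact: memvf.
rewrite exprS -add1n; apply: ideal_expM => //.
by rewrite /ideal_exp expv1 mem_maxideal /aug mxE coefX.
Qed.

Lemma xel4_neq0 : xel ^+ 4 != 0.
Proof.
apply/eqP => /(congr1 (fun b : A => xpart b 0 ord_max)).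
by rewrite xelX !mxE coefXn eqxx => /eqP; rewrite oner_eq0.
Qed.

Lemma apolar_socle_degree : socle_degree A = 4.
Proof.
have [nz max] := socle_degree_max A.
apply/eqP; rewrite eqn_leq; apply/andP; split.
  rewrite leqNgt; apply: contra nz => j5; rewrite -subv0; apply/subvP => a.
  by move/(ideal_exp5 j5)->; apply: mem0v.
apply: max; apply/negP => /eqP E; have := xel_exp 4.
by rewrite E memv0 (negPf xel4_neq0).
Qed.

Lemma dot_delta (w : 'rV[K]_c) k : dot (delta_mx 0 k) w = w 0 k.
Proof.
rewrite /dot (bigD1 k) //= mxE !eqxx mul1r big1 ?addr0 // => i ik.
by rewrite mxE eqxx (negPf ik) mul0r.
Qed.

Lemma aug_yel v : aug (yel v) = 0. Proof. by rewrite /aug mxE. Qed.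
Lemma aug_Yel v : aug (Yel v) = 0. Proof. by rewrite /aug mxE. Qed.

Lemma xpart_mul_yel a v :
  xpart (a * yel v) = dot v (Ypart a) *: socle K.
Proof.
rewrite mulE xpart_mul /= [dot (ypart a) _]dotC dot0 add0r.
rewrite tmulC (_ : xpart (yel v) = 0) // -(scale0r (0 : 'rV[K]_5)) tmulZl scale0r.
by rewrite add0r.
Qed.

Lemma xpart_mul_Yel a v :
  xpart (a * Yel v) = dot v (ypart a) *: socle K.
Proof.
rewrite mulE xpart_mul /= dot0 addr0 [dot (ypart a) _]dotC.
rewrite tmulC (_ : xpart (Yel v) = 0) // -(scale0r (0 : 'rV[K]_5)) tmulZl scale0r.
by rewrite add0r.
Qed.

Lemma socle_neq0 : socle K != 0.
Proof.
apply/eqP => /rowP/(_ ord_max); rewrite !mxE !eqxx => /eqP.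
by rewrite oner_eq0.
Qed.

(** An element a killed by m is a multiple of x^4: multiplication by x, Y_k and
    y_k shows that its coordinates along 1, ..., x^3, along y_k and along Y_k
    vanish. *)
Lemma apolar_gorenstein : gorenstein A.
Proof.
suff E : annihilator \m_A = <[xel ^+ 4]>%VS.
  by rewrite /gorenstein E dim_vline xel4_neq0.
apply/eqP; rewrite eqEsubv; apply/andP; split; last first.
  rewrite -memvE; apply/annihilatorP => u um; apply: filt5; apply: (@filtM _ _ _ 4 1).
    exact/ideal_exp_filt/xel_exp.
  by apply/filt1/eqP; rewrite -mem_maxideal.
apply/subvP => a /annihilatorP ann; apply/vlineP; exists (xpart a 0 ord_max).
have xm : xel \in \m_A by have := xel_exp 1; rewrite /ideal_exp expv1 expr1.
have ya : ypart a = 0.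
  apply/rowP => k; rewrite mxE -dot_delta; apply/eqP.
  have := congr1 (@xpart _ _ _) (ann (Yel (delta_mx 0 k)) _).
  rewrite mem_maxideal aug_Yel eqxx => /(_ isT)/eqP.
  by rewrite xpart_mul_Yel scaler_eq0 (negPf socle_neq0) orbF.
have Ya : Ypart a = 0.
  apply/rowP => k; rewrite mxE -dot_delta; apply/eqP.
  have := congr1 (@xpart _ _ _) (ann (yel (delta_mx 0 k)) _).
  rewrite mem_maxideal aug_yel eqxx => /(_ isT)/eqP.
  by rewrite xpart_mul_yel scaler_eq0 (negPf socle_neq0) orbF.
rewrite {1}[a]apolar_decomp ya Ya (_ : yel 0 = 0) // linear0 !addr0.
rewrite big_ord_recr big1 /= ?add0r // => l _.
rewrite -(@xpart_mulX a 1 (lift ord0 l)) ?expr1 ?ann ?mxE ?scale0r //.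
by rewrite /= /bump /= addnC.
Qed.

Lemma xpart_in_exp n a : (forall l : 'I_5, (l < n)%N -> xpart a 0 l = 0) ->
  \sum_(l < 5) xpart a 0 l *: xel ^+ l \in ideal_exp \m_A n.
Proof.
move=> xa; apply: rpred_sum => l _.
have [/xa->|nl] := ltnP l n; first by rewrite scale0r mem0v.
apply: memvZ; exact: subvP (ideal_exp_le m_ideal nl) _ (xel_exp l).
Qed.

Hypothesis nondeg : \matrix_(i, k) gtensor g i i k \in unitmx.

Lemma yel_sqr i : yel (delta_mx 0 i) ^+ 2 = Yel (row i (\matrix_(i, k) gtensor g i i k)).
Proof.
rewrite expr2; apply: apolar_eq.
- by rewrite xpart_mul_yel (_ : Ypart _ = 0) // dotC dot0 scale0r.
- by rewrite mulE ypart_mul aug_yel !scale0r addr0.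
- rewrite mulE Ypart_mul aug_yel !scale0r !add0r; apply/rowP => k.
  rewrite !mxE (bigD1 i) //= (bigD1 i) //= !mxE !eqxx !mulr1.
  rewrite !big1 ?addr0 // => l li; last by rewrite mxE (negPf li) andbF mulr0 mulr0.
  by rewrite big1 // => l' _; rewrite mxE (negPf li) andbF mul0r mulr0.
Qed.

(** By [yel_sqr] the squares of the y_i are combinations of the Y_k with an
    invertible matrix. *)
Lemma Yel_exp w : Yel w \in ideal_exp \m_A 2.
Proof.
rewrite -[w](mulmxKV nondeg) mulmx_sum_row linear_sum.
apply: rpred_sum => i _; rewrite linearZ memvZ //= -yel_sqr.
by rewrite /ideal_exp; apply: memv_mul => //; rewrite ?expv1 mem_maxideal aug_yel.
Qed.

Lemma mem_ideal_exp2 a : a \in ideal_exp \m_A 2 <-> filt 2 a.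
Proof.
split=> [/ideal_exp_filt //|[xa ya _]].
rewrite [a]apolar_decomp ya // (_ : yel 0 = 0) // add0r rpredD ?Yel_exp //.
exact: xpart_in_exp.
Qed.

(** Both m and m^2 are kernels of surjections, onto K and onto
    K x K x K^c. *)
Lemma apolar_embdim : embdim A = c.+1.
Proof.
have d1 : (\dim \m_A + 1 = 5 + c + c)%N.
  rewrite -dim_apolar -(@dim_lker_onto _ A K^o (@aug_fun K c g)) ?dimvf ?dim_regular //.
  by move=> s; exists ((s : K) *: (1 : A)); rewrite /= /aug_fun augZ aug1 mulr1.
pose f (a : A) : K^o * K^o * 'rV[K]_c := (aug a, xpart a 0 1, ypart a).
have f_lin : linear f.
  move=> s a b; rewrite /f augD augZ xpartD xpartZ ypartD ypartZ !mxE.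
  by [].
pose fL := GRing.isLinear.Build K A _ _ f f_lin.
pose F : {linear A -> (K^o * K^o * 'rV[K]_c)%type} := HB.pack f fL.
have d2 : (\dim (ideal_exp \m_A 2) + (1 + 1 + c) = 5 + c + c)%N.
  rewrite -dim_apolar -(@dim_lker_onto _ A _ F).
    rewrite dimvf (_ : dim _ = 1 + 1 + dim 'rV[K]_c)%N // dim_matrix mul1r; congr (\dim _ + _)%N.
    apply/eqP; rewrite eqEsubv; apply/andP; split; apply/subvP => a.
      move/mem_ideal_exp2 => [xa ya _]; rewrite memv_ker lfunE /= /f /aug !xa // ya //.
    rewrite memv_ker lfunE /= => /eqP[a0 a1 ya]; apply/mem_ideal_exp2.
    split=> // l; case: l => [[|[|l]] ll] //= _.
      by rewrite -[RHS]a0; congr (xpart a 0 _); apply: val_inj.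
    by rewrite -[RHS]a1; congr (xpart a 0 _); apply: val_inj.
  move=> [[s t] v]; exists (xinj (s *: delta_mx 0 0 + t *: delta_mx 0 1) + yel v).
  rewrite /= /f /aug /xpart /ypart /= !mxE !eqxx /=.
  by rewrite !mulr1 !mulr0 !addr0 !add0r.
by rewrite /embdim; lia.
Qed.

End Structure.

(** * The apolar algebra of a general cubic is not smoothable *)

Section NonSmoothable.
Variables (K : closedFieldType) (c n : nat).
Local Notation r := (size (cubic_monomials c)).
Local Notation mono := (tnth (in_tuple (cubic_monomials c))).

Lemma xpart_mul3 (g : 'X_{1..c} -> K) i j k :
  xpart (yel g (delta_mx 0 i) * yel g (delta_mx 0 j) * yel g (delta_mx 0 k)) 0 ord_max
  = gtensor g i j k.
Proof.
rewrite xpart_mul_yel !mxE !eqxx mulr1 mulE Ypart_mul !aug_yel !scale0r !add0r /=.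
rewrite dot_delta mxE (bigD1 i) //= (bigD1 j) //= !mxE !eqxx !mulr1.
rewrite !big1 ?addr0 // => [l lj|l li].
  by rewrite big1 // => l' _; rewrite mxE (negPf lj) andbF mul0r mulr0.
by rewrite mxE (negPf li) andbF !mulr0.
Qed.

(** Lift the y_i to combinations of the monomials b of a chart around the ideal
    I of the algebra, and extend the functional sigma to nearby ideals J by
    keeping its values ph on the basis b.  Then sigma(y_i y_j y_k) is a linear
    form L in the coordinates of J along the products of three monomials of b.
    The locus P(L) != 0 is an open neighbourhood of I without reduced points. *)
Lemma not_smoothable_apolar (g : 'X_{1..c} -> K) (P : {mpoly K[r]}) :
  \dim (fullv : {vspace apolar g}) = n ->
  secant_poly n P -> P.@[fun t => g (mono t)] != 0 -> ~ smoothable (apolar g).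
Proof.
move=> dimA Psec Pg [N [n' [phi [I [phi_surj phi_ker clos]]]]].
have En : n' = n by rewrite -dimA (hilb_dim phi_surj phi_ker).
subst n'.
have [b Hb] := monomial_basis phi_surj phi_ker.
pose sg (a : apolar g) : K := xpart a 0 ord_max.
pose ph l := sg (phi 'X_[b l]).
have /fin_all_exists[u uP] : forall i : 'I_c, exists u : 'rV[K]_n,
    phi (\sum_l u 0 l *: 'X_[b l]) = yel g (delta_mx 0 i).
  move=> i; have [p <-] := phi_surj (yel g (delta_mx 0 i)).
  have [u Hu] := coords_exists Hb p; exists u; move/phi_ker: Hu.
  by rewrite linearB /= => /eqP; rewrite subr_eq0 => /eqP.
pose y i : {mpoly K[N]} := \sum_l u i 0 l *: 'X_[b l].
have /fin_all_exists[tri triP] : forall t : 'I_r, exists x : 'I_c * 'I_c * 'I_c,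
    mono t = (U_(x.1.1) + U_(x.1.2) + U_(x.2))%MM.
  move=> t; have [i [j [k E]]] := cubic_monomialP (mem_tnth t (in_tuple (cubic_monomials c))).
  by exists (i, j, k).
pose T := ('I_n * 'I_n * 'I_n)%type.
pose w (x : 'I_#|{: T}|) := let: (l1, l2, l3) := (enum_val x : T) in (b l1 + b l2 + b l3)%MM.
pose wc i j k (x : 'I_#|{: T}|) := let: (l1, l2, l3) := (enum_val x : T) in
  u i 0 l1 * u j 0 l2 * u k 0 l3.
have yyyE i j k : y i * y j * y k = \sum_x wc i j k x *: 'X_[w x].
  rewrite /y big_distrlr /= pair_bigA big_distrlr /= pair_bigA /=.
  rewrite (reindex_onto (enum_val : 'I_#|{: T}| -> T) enum_rank) /=; last first.
    by move=> x _; rewrite enum_rankK.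
  rewrite big_mkcond; apply: eq_bigr => x _; rewrite enum_valK eqxx /wc /w.
  case: (enum_val x) => [[l1 l2] l3] /=.
  by rewrite !mpolyXD -!scalerAl -!scalerAr -!scalerAl !scalerA; congr (_ *: _); ring.
pose L (t : 'I_r) : {mpoly K[#|{: T}| * n]} :=
  \sum_x \sum_l (wc (tri t).1.1 (tri t).1.2 (tri t).2 x * ph l) *: 'X_(mxvec_index x l).
have LE (J : hilb K N n) (C : 'M[K]_(#|{: T}|, n)) t :
    basis_mod J (fun i => 'X_[b i]) ->
    (forall x, J ('X_[w x] - \sum_i C x i *: 'X_[b i])) ->
    exists2 e, coords J (fun i => 'X_[b i]) (y (tri t).1.1 * y (tri t).1.2 * y (tri t).2) e
      & (L t).@[mxvec C 0] = \sum_l e 0 l * ph l.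
  move=> Jb JC; exists (\sum_x wc (tri t).1.1 (tri t).1.2 (tri t).2 x *: row x C).
    rewrite yyyE; elim/big_ind2: _ => [|p e q f|x _].
    - by apply/coords0/hilb0.
    - exact: coordsD.
    apply: coordsZ; rewrite /coords; under eq_bigr do rewrite mxE.
    exact: JC.
  rewrite rmorph_sum /=.
  under eq_bigr do rewrite rmorph_sum /=.
  rewrite exchange_big; apply: eq_bigr => l _.
  rewrite summxE mulr_suml; apply: eq_bigr => x _.
  by rewrite mevalZ mevalXU mxvecE !mxE mulrAC.
pose f := P \mPo [tuple L t | t < r].
have fE C : f.@[mxvec C 0] = P.@[fun t => (L t).@[mxvec C 0]].
  by rewrite comp_mpoly_meval; apply: meval_eq => t; rewrite tnth_mktuple.
have UI : principal_open b w f I.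
  split=> //; have [C0 C0P] := fin_all_exists (fun x => coords_exists Hb 'X_[w x]).
  have CI x : I ('X_[w x] - \sum_i (\matrix_x C0 x) x i *: 'X_[b i]).
    by have := C0P x; rewrite /coords; congr (I (_ - _)); apply: eq_bigr => i _; rewrite mxE.
  exists (\matrix_x C0 x); split=> //.
  rewrite fE (meval_eq (v2 := fun t => g (mono t))) // => t.
  have [e He ->] := LE I _ t Hb CI.
  transitivity (sg (phi (y (tri t).1.1 * y (tri t).1.2 * y (tri t).2))).
    move/phi_ker: He; rewrite linearB /= => /eqP; rewrite subr_eq0 => /eqP->.
    rewrite linear_sum /sg /ph.
    elim/big_ind2: _ => [|x1 x2 y1 y2 -> ->|l _]; first by rewrite mxE.
      by rewrite xpartD mxE.
    by rewrite linearZ /= xpartZ mxE.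
  by rewrite !rmorphM /= !uP /sg xpart_mul3 triP.
have [J [[Jb [C [JC fC]]] Jred]] := clos _ (fun J UJ => ex_intro _ b (ex_intro _ _
  (ex_intro _ w (ex_intro _ f (conj UJ (fun _ H => H)))))) UI.
have [s [a sa]] := reduced_cubic_form ph y Jred Jb.
case/negP: fC; rewrite fE (meval_eq (v2 := fun t => \sum_q s q * ('X_[mono t]).@[a q])); last first.
  move=> t; have [e He ->] := LE J C t Jb JC; rewrite (sa _ _ _ _ He).
  apply: eq_bigr => q _; congr (_ * _).
  by rewrite triP !mpolyXD !mevalM !mevalXU.
by rewrite Psec eqxx.
Qed.

End NonSmoothable.

(** The determinant D of the matrix (G_iik) is a nonzero polynomial in the
    coefficients of G, as its value is 1 when G is the sum of the divided cubes
    of the variables; so P D does not vanish at some point. *)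
Lemma generic_cubic (K : closedFieldType) c n :
  (n * c.+1 < size (cubic_monomials c))%N ->
  exists (g : 'X_{1..c} -> K) (P : {mpoly K[size (cubic_monomials c)]}),
   [/\ \matrix_(i, k) gtensor g i i k \in unitmx, secant_poly n P &
       P.@[fun t => g (tnth (in_tuple (cubic_monomials c)) t)] != 0].
Proof.
move=> nr; have [P P0 Psec] := @secant_equation K c n nr.
set r := size _ in P P0 Psec *.
pose mono := tnth (in_tuple (cubic_monomials c)).
have r0 : (0 < r)%N by apply: leq_ltn_trans nr.
pose idx (m : 'X_{1..c}) : 'I_r := insubd (Ordinal r0) (index m (cubic_monomials c)).
have monoK t : idx (mono t) = t.
  apply: val_inj; rewrite /= /idx /mono (tnth_nth 0%MM) /= index_uniq ?uniq_basis //.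
  by rewrite val_insubd ltn_ord.
have idxK m : m \in cubic_monomials c -> mono (idx m) = m.
  move=> mc; rewrite /mono (tnth_nth 0%MM) /= val_insubd index_mem mc.
  by rewrite nth_index.
pose D : {mpoly K[r]} := \det (\matrix_(i < c, k < c) 'X_(idx (U_(i) + U_(i) + U_(k))%MM)).
have DE v : D.@[v] = \det (\matrix_(i, k) gtensor (v \o idx) i i k).
  rewrite -det_map_mx; congr (\det _); apply/matrixP => i k.
  by rewrite !mxE /= mevalXU.
have D0 : D != 0.
  pose v t : K := [exists i : 'I_c, mono t == (U_(i) + U_(i) + U_(i))%MM]%:R.
  apply/eqP => /(congr1 (meval v)); rewrite DE meval0.
  rewrite (_ : \matrix_(_, _) _ = 1%:M) ?det1; first by move/eqP; rewrite oner_eq0.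
  apply/matrixP => i k; rewrite !mxE /gtensor /= /v idxK ?mem_cubic //.
  case: eqVneq => [->|ik]; first by rewrite (introT existsP) //; exists k.
  case: existsP => // -[l /eqP/mnmP E].
  have := E i; have := E k; rewrite !mnmE !eqxx (eq_sym k i) (negPf ik) /=.
  by case: (l == i); case: (l == k).
have [v] := mpoly_nonroot (mulf_neq0 P0 D0).
rewrite mevalM mulf_eq0 negb_or => /andP[Pv Dv].
exists (v \o idx), P; split=> //.
  by rewrite unitmxE unitfE -DE.
by rewrite (meval_eq (v2 := v)) // => t; rewrite /= monoK.
Qed.

(** * The first symmetric quotient *)

Local Open Scope quotient_scope.

Section QuotMorphism.
Variables (K : fieldType) (R : comAlgType K) (I : idealr R).
Definition quot_pi (x : R) : {ideal_quot I} := \pi_{ideal_quot I} x.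
Lemma quot_pi_additive : additive quot_pi.
Proof. by move=> x y; rewrite /quot_pi rmorphB. Qed.
Lemma quot_pi_multiplicative : multiplicative quot_pi.
Proof. by split=> [x y|]; rewrite /quot_pi ?rmorphM ?rmorph1. Qed.
Lemma quot_pi_scalable : scalable quot_pi.
Proof. by move=> s x; symmetry; apply: quot_scale_pi. Qed.
HB.instance Definition _ := GRing.isAdditive.Build R {ideal_quot I} quot_pi quot_pi_additive.
HB.instance Definition _ := GRing.isMultiplicative.Build R {ideal_quot I} quot_pi quot_pi_multiplicative.
HB.instance Definition _ := GRing.isScalable.Build K R {ideal_quot I} *:%R quot_pi quot_pi_scalable.
Lemma quot_pi_eq0 x : quot_pi x = 0 <-> x \in I.
Proof.
rewrite -[0](raddf0 quot_pi) /= /quot_pi.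
split=> [/eqP|H]; rewrite -?Quotient.idealrBE ?subr0 //.
by apply/eqP; rewrite -Quotient.idealrBE subr0.
Qed.
End QuotMorphism.

Section EvalAt.
Variables (K : fieldType) (R : comAlgType K) (x : R).

Definition eval_at (p : {mpoly K[1]}) : R := mmap (in_alg R) (fun=> x) p.

Lemma eval_at_additive : additive eval_at.
Proof. exact: mmap_is_additive. Qed.
Lemma eval_at_multiplicative : multiplicative eval_at.
Proof. exact: mmap_is_multiplicative. Qed.
Lemma eval_at_scalable : scalable eval_at.
Proof. by move=> s p; rewrite /eval_at mmapZ /= mulr_algl. Qed.
HB.instance Definition _ :=
  GRing.isAdditive.Build {mpoly K[1]} R eval_at eval_at_additive.
HB.instance Definition _ :=
  GRing.isMultiplicative.Build {mpoly K[1]} R eval_at eval_at_multiplicative.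
HB.instance Definition _ :=
  GRing.isScalable.Build K {mpoly K[1]} R *:%R eval_at eval_at_scalable.

Lemma eval_atX m : eval_at 'X_[m] = x ^+ m ord0.
Proof. by rewrite /eval_at mmapX /mmap1 big_ord1. Qed.

Lemma eval_atE p : eval_at p = \sum_(m <- msupp p) p@_m *: x ^+ m ord0.
Proof.
rewrite {1}[p]mpolyE raddf_sum /=; apply: eq_bigr => m _.
by rewrite linearZ /= eval_atX.
Qed.
End EvalAt.

(** The last two hypotheses say that x induces an isomorphism of K[X]/X^d with
    B. *)
Lemma fat_point_smoothable (K : closedFieldType) d (R B : comAlgType K)
    (pi : {lrmorphism R -> B}) (x : R) :
  (forall y, exists z, pi z = y) ->
  (forall z, exists p, pi (z - eval_at x p) = 0) ->
  (forall p, pi (eval_at x p) = 0 <-> forall i, (i < d)%N -> ucoef p i = 0) ->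
  smoothable B.
Proof.
move=> pi_surj eval_surj.
have [phi phiE] : exists phi : {lrmorphism {mpoly K[1]} -> B},
    forall p, pi (eval_at x p) = phi p.
  by exists (pi \o eval_at x).
move=> ker; have {}ker p : phi p = 0 <-> forall i, (i < d)%N -> ucoef p i = 0.
  by rewrite -phiE.
pose I p := phi p = 0.
have Ip : ideal_pred I.
  split=> [|p q Hp Hq|p q Hq]; rewrite /I; first exact: rmorph0.
    by rewrite rmorphD /= Hp Hq addr0.
  by rewrite rmorphM /= Hq mulr0.
have Ib : exists b : 'I_d -> {mpoly K[1]}, basis_mod I b.
  exists (fun i => 'X_[U_(ord0) *+ i]) => p.
  have E (r : 'rV[K]_d) : I (p - \sum_(i < d) r 0 i *: 'X_[U_(ord0) *+ i]) <-> r = \row_(i < d) ucoef p i.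
    have ucoefE (l : 'I_d) : ucoef (p - \sum_(i < d) r 0 i *: 'X_[U_(ord0) *+ i]) l = ucoef p l - r 0 l.
      rewrite ucoefB ucoef_sum (bigD1 l) //= big1 => [|i il].
        by rewrite ucoefZ ucoefX mulmnE mnm1E eqxx mul1n eqxx mulr1 addr0.
      by rewrite ucoefZ ucoefX mulmnE mnm1E eqxx mul1n (inj_eq val_inj) (negPf il) mulr0.
    rewrite /I ker; split=> [H|Er i id].
      by apply/rowP => l; rewrite mxE; apply/eqP; rewrite eq_sym -subr_eq0 -ucoefE H.
    by rewrite -[i]/(val (Ordinal id)) ucoefE Er mxE subrr.
  by exists (\row_i ucoef p i); split=> [|r /E ->]; first exact/E.
exists 1%N, d, phi, (Hilb Ip Ib); split=> //.
  move=> y; have [z <-] := pi_surj y; have [p] := eval_surj z.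
  by move/eqP; rewrite raddfB /= subr_eq0 phiE => /eqP ->; exists p.
by apply: fat_point_closure => p; apply: ker.
Qed.

Lemma fat_point_double_quotient (K : closedFieldType) d (R : comAlgType K)
    (I : idealr R) (J : idealr {ideal_quot I}) (x : R) :
  (forall z, exists p, quot_pi I (z - eval_at x p) \in J) ->
  (forall p, quot_pi I (eval_at x p) \in J <-> forall i, (i < d)%N -> ucoef p i = 0) ->
  smoothable {ideal_quot J}.
Proof.
move=> H1 H2; pose pi : {lrmorphism R -> {ideal_quot J}} := quot_pi J \o quot_pi I.
apply: (@fat_point_smoothable K d R _ pi x) => [y|z|p].
- by exists (repr (repr y)); rewrite /= /quot_pi !reprK.
- by have [p Hp] := H1 z; exists p; apply/quot_pi_eq0.
- by apply: iff_trans (H2 p); apply: quot_pi_eq0.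
Qed.

Section FirstQuotient.
Variables (K : closedFieldType) (c : nat) (g : 'X_{1..c} -> K).
Local Notation A := (apolar g).
Hypothesis nondeg : \matrix_(i, k) gtensor g i i k \in unitmx.
Let m_ideal : is_ideal \m_A := maxideal_ideal A.

(** Write a = sum_l p_l x^l + y + Y.  As a lies in m^i, the part y + Y is in
    C(1)_i: it vanishes for i > 2, and otherwise it is killed by m^(4 - i).  The
    rest lies in m^(i + 1) up to p_i x^i; and p_i is the socle coordinate of
    a x^(4 - i), which vanishes for a in C(1)_i. *)
Lemma iarrobino_degP i (a : A) : a \in ideal_exp \m_A i ->
  (a \in (iarrobino_deg A 1 i + ideal_exp \m_A i.+1)%VS) <->
  forall l : 'I_5, l = i :> nat -> xpart a 0 l = 0.
Proof.
move=> ai; have [xa ya Ya] := ideal_exp_filt ai; split.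
  case/memv_addP => u uC [v vi Ea] l li; rewrite Ea xpartD mxE.
  have [xv _ _] := ideal_exp_filt vi; rewrite xv ?li // addr0.
  have l4 : (i + (4 - i) = (ord_max : 'I_5))%N by have := ltn_ord l; rewrite li /=; lia.
  move: uC; rewrite memv_cap => /andP[_ /annihilatorP ann].
  rewrite -li in l4; rewrite -(xpart_mulX u l4) ann ?mxE //.
  by rewrite apolar_socle_degree li subSS subn0; apply: xel_exp.
move=> xi; rewrite [a]apolar_decomp addrC.
have sum_i : \sum_(l < 5) xpart a 0 l *: xel g ^+ l \in ideal_exp \m_A i.+1.
  by apply: xpart_in_exp => l; rewrite ltnS leq_eqVlt => /orP[/eqP/xi|/xa].
apply: memv_add => //; rewrite memv_cap; apply/andP; split.
  have : a - \sum_(l < 5) xpart a 0 l *: xel g ^+ l \in ideal_exp \m_A i.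
    by rewrite rpredB //; apply: (subvP (ideal_expS _ m_ideal)) sum_i.
  by rewrite {1}[a]apolar_decomp addrAC subrr add0r.
rewrite apolar_socle_degree; apply/annihilatorP => u uI.
have [xu yu Yu] := ideal_exp_filt uI.
have [i2|i2] := ltnP 2 i.
  have -> : ypart a = 0 by apply: ya; lia.
  by rewrite Ya // (_ : yel g 0 = 0) // linear0 addr0 mul0r.
have u0 : aug u = 0 by apply: xu; rewrite /=; lia.
have yu0 : ypart u = 0 by apply: yu; lia.
have v0 : dot (ypart a) (Ypart u) = 0.
  have [i1|i1] := ltnP 1 i; first by rewrite ya // dot0.
  by rewrite Yu ?[dot _ 0]dotC ?dot0 //; lia.
have z0 : aug (yel g (ypart a) + Yel g (Ypart a)) = 0.
  by rewrite augD aug_yel aug_Yel addr0.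
rewrite mulE /apolar_mul z0 u0 yu0 !scaler0 !scale0r [contract _ _ 0]contractC contract0.
rewrite ypartD YpartD (_ : ypart (Yel g _) = 0) // (_ : Ypart (yel g _) = 0) //.
rewrite addr0 add0r v0 dot0 !addr0 scale0r addr0 tmulC.
rewrite xpartD (_ : xpart (yel g _) = 0) // (_ : xpart (Yel g _) = 0) // addr0.
by rewrite -(scale0r (0 : 'rV[K]_5)) [tmul _ (_ *: _)]tmulC tmulZl scale0r.
Qed.

Lemma xT_subproof : ((xel g)%:P * 'X : {poly A}) \in @rees_pred K A.
Proof.
apply/rees_predP => -[|[|i]]; rewrite coefCM coefX ?mulr0 ?mem0v ?mulr1 //.
by have := xel_exp g 1; rewrite expr1.
Qed.
(** The element x in degree 1 of the Rees algebra. *)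
Definition xT : rees A := Rees xT_subproof.

Lemma coef_xTX n i : ((xT ^+ n : rees A) : {poly A})`_i = xel g ^+ n *+ (i == n).
Proof.
rewrite (_ : (xT ^+ n : rees A) = (xel g)%:P ^+ n * 'X^n :> {poly A}).
  by rewrite -polyC_exp coefCM coefXn mulr_natr.
elim: n => [|n IH]; first by rewrite !expr0 mulr1.
by rewrite exprS /= IH !exprS mulrACA.
Qed.

(** Q(0) only retains the coefficient of x^l in each degree l. *)
Lemma gr_class_iarrobino1 (x : rees A) : gr_class x \in iarrobino 1 <->
  forall l : 'I_5, xpart (x : {poly A})`_l 0 l = 0.
Proof.
split=> [/iarrobino_class H l|H].
  by have /iarrobino_degP := H l; apply=> //; apply: reesP.
apply/iarrobino_class => i; apply/iarrobino_degP => [|l <-]; last exact: H.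
exact: reesP.
Qed.

Lemma coef_eval_xT p i : (eval_at xT p : {poly A})`_i = ucoef p i *: xel g ^+ i.
Proof.
rewrite eval_atE.
transitivity (\sum_(m <- msupp p) p@_m *: (xel g ^+ m ord0 *+ (i == m ord0))).
  elim/big_ind2: _ => [|x u y v <- <-|m _]; [exact: coef0|exact: coefD|].
  by rewrite -coef_xTX coefZ mulr_algl.
rewrite (_ : ucoef p i = \sum_(m <- msupp p) p@_m * (m ord0 == i)%:R).
  rewrite scaler_suml; apply: eq_bigr => m _.
  by rewrite eq_sym; case: eqP => [->|_]; rewrite ?mulr1 ?mulr0 ?scale0r ?scaler0.
rewrite {1}[p]mpolyE [ucoef _ _]raddf_sum; apply: eq_bigr => m _ /=.
by rewrite mcoeffZ -/(ucoef _ _) ucoefX.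
Qed.

Lemma xpart_xelX (l : 'I_5) : xpart (xel g ^+ l) 0 l = 1.
Proof. by rewrite xelX mxE coefXn eqxx. Qed.

Lemma first_quotient_smoothable : smoothable (first_quotient A).
Proof.
apply: (@fat_point_double_quotient K 5 (rees A) (@rees_shift K A) (@iarrobino K A 1) xT).
- move=> z; exists (\sum_(l < 5) xpart (z : {poly A})`_l 0 l *: 'X_[U_(ord0) *+ l]).
  apply/gr_class_iarrobino1 => l.
  rewrite coef_reesB coef_eval_xT -scaleNr xpartD xpartZ mxE [X in _ + X]mxE.
  rewrite xpart_xelX mulr1 ucoef_sum (bigD1 l) //= big1 => [|k kl].
    by rewrite ucoefZ ucoefX mulmnE mnm1E eqxx mul1n eqxx mulr1 addr0 subrr.
  by rewrite ucoefZ ucoefX mulmnE mnm1E eqxx mul1n (inj_eq val_inj) (negPf kl) mulr0.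
- move=> p; split=> [/gr_class_iarrobino1 H i i5|H].
    by have := H (Ordinal i5); rewrite coef_eval_xT xpartZ mxE xpart_xelX mulr1.
  by apply/gr_class_iarrobino1 => l; rewrite coef_eval_xT H // scale0r mxE.
Qed.
End FirstQuotient.

Theorem theorem1 (k : closedFieldType) :
  exists A : localAlgType k,
    [/\ gorenstein A,
        \dim (fullv : {vspace A}) = 31%N,
        embdim A = 14%N,
        ~ smoothable A &
        smoothable (first_quotient A)].
Proof.
have size_cubics : size (cubic_monomials 13) = 455%N by rewrite size_basis.
have [|g [P [nondeg secantP gP]]] := @generic_cubic k 13 31.
  by rewrite size_cubics.
exists (apolar g); split.
- exact: apolar_gorenstein.
- by rewrite dim_apolar.
- exact: apolar_embdim.
- by apply: not_smoothable_apolar secantP gP; rewrite dim_apolar.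
- exact: first_quotient_smoothable.
Qed.
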